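(* Let $\Gamma$ be a tropical curve of genus $g\leq 4$ and let $D$ be an effective divisor on $\Gamma$ such that $0<\deg D<2g-2$ and $$\mathrm{rk}|D| = \frac{\deg D}{2}.$$ Then $\Gamma$ is hyperelliptic.
   Context: A graph is a finite connected multigraph; loops and multiple edges are allowed. A tropical curve is a pair $(\Gamma,l)$ consisting of a graph $\Gamma$ with vertex set $V(\Gamma)$ and edge set $E(\Gamma)$ and a length function $l: E(\Gamma)\to \mathbb{R}_{>0}\cup\{\infty\}$ (a metric graph with possibly unbounded ends), regarded as a topological space by identifying each edge of finite length with a real interval of that length. Each edge of infinite length is identified with $[0,\infty]$, where the end $\infty$ is a vertex of valence $1$ (a point at infinity). The genus is $g = |E(\Gamma)|-|V(\Gamma)|+1$. A divisor on $\Gamma$ is a formal finite $\mathbb{Z}$-linear combination $D=\sum a_i p_i$ of points $p_i\in\Gamma$. Its degree is $\deg D = \sum a_i$. It is effective, written $D\ge 0$, if all $a_i\ge 0$. A rational function on $\Gamma$ is a continuous function $f:\Gamma\to\mathbb{R}\cup\{\pm\infty\}$, taking the values $\pm\infty$ only at points at infinity, whose restriction to each edge is piecewise linear with integer slopes and finitely many pieces. For $P\in\Gamma$, $\mathrm{ord}_P f$ is the sum of the slopes of $f$ along all segments outgoing from $P$. The principal divisor of $f$ is $(f)=\sum_{P\in\Gamma}\mathrm{ord}_P f\cdot P$. Two divisors are linearly equivalent, $D\sim E$, if $D-E$ is principal. The complete linear system of $D$ is $|D|=\{E \text{ divisor}: E\ge 0,\ E\sim D\}$. The rank is $\mathrm{rk}|D|=-1$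 if $|D|=\emptyset$; otherwise it is the maximum of the integers $r\geq 0$ such that $|D-E|\ne\emptyset$ for every effective divisor $E$ of degree $r$. The tropical curve $\Gamma$ is hyperelliptic if there is a divisor $E$ on $\Gamma$ with $\deg E=2$ and $\mathrm{rk}|E|=1$. *)

(* Defs.v *)
From HB Require Import structures.
From mathcomp Require Import all_boot all_order all_algebra.
From mathcomp Require Import all_classical all_reals all_analysis.
From mathcomp Require Import freeg.
Set Implicit Arguments.
Unset Strict Implicit.
Unset Printing Implicit Defensive.
Import Order.TTheory GRing.Theory Num.Theory.
Import numFieldNormedType.Exports.
Local Open Scope classical_set_scope.
Local Open Scope ring_scope.

(** Edges carry an auxiliary orientation, which only serves to parametrize
    them.  A loop is an edge with [esrc e = etgt e]. *)
Record multigraph := Multigraph {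
  vertex : finType;
  edge : finType;
  esrc : edge -> vertex;
  etgt : edge -> vertex }.

Definition adjacent (G : multigraph) : rel (vertex G) := fun u v =>
  [exists e : edge G, ((esrc e == u) && (etgt e == v)) ||
                      ((esrc e == v) && (etgt e == u))].

Definition graph_connected (G : multigraph) : Prop :=
  (0 < #|vertex G|)%N /\ forall u v : vertex G, connect (@adjacent G) u v.

(** A loop contributes 2 to the valence of its vertex. *)
Definition valence (G : multigraph) (v : vertex G) : nat :=
  (#|[set e : edge G | esrc e == v]%SET| + #|[set e : edge G | etgt e == v]%SET|)%N.

(** An edge of infinite length is oriented towards its point at infinity, so
    that its parameter [0, +oo] runs from [esrc e] to [etgt e]. *)
Record tropical_curve (R : realType) := TropicalCurve {
  underlying_graph :> multigraph;
  len : edge underlying_graph -> \bar R;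
  len_gt0 : forall e, (0 < len e)%E;
  graph_conn : graph_connected underlying_graph;
  len_infty : forall e, len e = +oo%E -> valence (etgt e) = 1%N }.

Definition genus (R : realType) (G : tropical_curve R) : int :=
  #|edge G|%:Z - #|vertex G|%:Z + 1.

Definition is_inner (R : realType) (G : tropical_curve R)
  (p : edge G * R) : bool := (0 < p.2) && (p.2%:E < len p.1)%E.

(** The pair (e, t) stands for the interior point of e with parameter t. *)
Definition tpoint (R : realType) (G : tropical_curve R) : Type :=
  (vertex G + {p : edge G * R | is_inner p})%type.

HB.instance Definition _ (R : realType) (G : tropical_curve R) :=
  Choice.copy (tpoint G) (vertex G + {p : edge G * R | is_inner p})%type.

Section Topology.
Context (R : realType) (G : tropical_curve R).
Local Open Scope ereal_scope.

(** The parametrization of the edge e by [0, len e]; values of the parameter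
    outside of this interval are irrelevant. *)
Definition edge_point (e : edge G) (t : \bar R) : tpoint G :=
  match t with
  | r%:E => if (insub (e, r) : option {p | is_inner p}) is Some p then inr p
            else inl (if (r <= 0)%R then esrc e else etgt e)
  | +oo => inl (etgt e)
  | -oo => inl (esrc e)
  end.

Definition edge_dom (e : edge G) : set (\bar R) := [set t | 0 <= t <= len e].

(** The topology of the space obtained by gluing the intervals [0, len e] at
    the vertices, i.e. the final topology for the parametrizations. *)
Definition tpoint_open (U : set (tpoint G)) : Prop :=
  forall e : edge G,
    open (edge_point e @^-1` U : set (subspace (edge_dom e))).

Lemma tpoint_openT : tpoint_open setT.
Proof. by move=> e; exact: openT. Qed.

Lemma tpoint_openI : setI_closed tpoint_open.
Proof. by move=> A B oA oB e; exact: openI (oA e) (oB e). Qed.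

Lemma tpoint_open_bigU (I : Type) (f : I -> set (tpoint G)) :
  (forall i, tpoint_open (f i)) -> tpoint_open (\bigcup_i f i).
Proof.
move=> of_ e; rewrite preimage_bigcup; apply: bigcup_open => i _.
exact: of_.
Qed.

HB.instance Definition _ := isOpenTopological.Build (tpoint G)
  tpoint_openT tpoint_openI tpoint_open_bigU.

End Topology.

Definition at_infinity (R : realType) (G : tropical_curve R) (P : tpoint G) :
    Prop :=
  exists e : edge G, len e = +oo%E /\ P = inl (etgt e).

(** h is real-valued and affine of slope m on the open interval ]a, b[. *)
Definition affine_on (R : realType) (h : \bar R -> \bar R) (a b : \bar R)
    (m : int) : Prop :=
  forall x y : R, (a < x%:E < b)%E -> (a < y%:E < b)%E ->
    h x%:E \is a fin_num /\ h y%:E = (h x%:E + (m%:~R * (y - x))%:E)%E.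

(** h is piecewise affine with integer slopes and finitely many pieces on
    [0, L], the breakpoints being 0 followed by s. *)
Definition piecewise_linear (R : realType) (L : \bar R) (h : \bar R -> \bar R) :
    Prop :=
  exists s : seq (\bar R),
    [/\ path (fun x y => (x < y)%E) 0%E s, last 0%E s = L &
     forall i, (i < size s)%N ->
       exists m : int, affine_on h (nth 0%E (0%E :: s) i) (nth 0%E s i) m].

Definition rational_function (R : realType) (G : tropical_curve R)
    (f : tpoint G -> \bar R) : Prop :=
  [/\ continuous f,
      forall P, ~ at_infinity P -> f P \is a fin_num &
      forall e : edge G, piecewise_linear (len e) (f \o edge_point e)].

Notation divisor G := {freeg (tpoint G) / int}.

Section Divisors.
Context (R : realType) (G : tropical_curve R).

(** The slopes at the parameter t of the edge e, along the segments outgoing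
    in the direction of increasing, resp. decreasing, parameter; for a rational
    f and 0 <= t < len e, resp. 0 < t <= len e, they exist and are unique. *)
Definition fwd_slope (f : tpoint G -> \bar R) (e : edge G) (t : \bar R) : int :=
  xget 0 [set m : int | exists b : \bar R,
    (t < b <= len e)%E /\ affine_on (f \o edge_point e) t b m].

Definition bwd_slope (f : tpoint G -> \bar R) (e : edge G) (t : \bar R) : int :=
  - xget 0 [set m : int | exists a : \bar R,
    (0 <= a < t)%E /\ affine_on (f \o edge_point e) a t m].

Definition ord_at (f : tpoint G -> \bar R) (P : tpoint G) : int :=
  match P with
  | inl v => \sum_(e : edge G | esrc e == v) fwd_slope f e 0%E +
             \sum_(e : edge G | etgt e == v) bwd_slope f e (len e)
  | inr p => let: (e, t) := val p in
             fwd_slope f e t%:E + bwd_slope f e t%:E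
  end.

Definition effective (D : divisor G) : Prop := forall P, 0 <= coeff P D.

Definition divisor_of (f : tpoint G -> \bar R) : divisor G :=
  \sum_(P \in [set: tpoint G]) << ord_at f P *g P >>.

Definition principal (D : divisor G) : Prop :=
  exists2 f : tpoint G -> \bar R, rational_function f & D = divisor_of f.

Definition lin_equiv (D E : divisor G) : Prop := principal (D - E).

Definition linear_system (D : divisor G) : set (divisor G) :=
  [set E | effective E /\ lin_equiv E D].

(** The condition on r whose maximal solution is the rank. *)
Definition rank_ge (D : divisor G) (r : nat) : Prop :=
  forall E : divisor G, effective E -> deg E = r%:Z ->
    linear_system (D - E) !=set0.

(** The maximum exists whenever |D| is nonempty, since [rank_ge D r] forces
    r <= deg D; the default value of [xget] is never used. *)
Definition rank (D : divisor G) : int :=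
  if pselect (linear_system D !=set0) then
    (xget 0%N [set r : nat | rank_ge D r /\
                             forall s, rank_ge D s -> (s <= r)%N])%:Z
  else -1.

Definition hyperelliptic : Prop :=
  exists E : divisor G, deg E = 2 /\ rank E = 1.

End Divisors.

(* Main.v *)
Require Import Defs.
From mathcomp Require Import all_boot all_order all_algebra.
From mathcomp Require Import all_classical all_reals all_analysis.
From mathcomp Require Import freeg.
From mathcomp Require Import zify ring lra.
Set Implicit Arguments.
Unset Strict Implicit.
Unset Printing Implicit Defensive.
Import Order.TTheory GRing.Theory Num.Theory.
Import numFieldNormedType.Exports.
Local Open Scope ring_scope.

(** The degree of D is 2 or 4, since it is even, positive and less than
    2 g - 2 <= 6.  If it is 2, then D itself has degree 2 and rank 1.  If it is 4,
    then g = 4 and the residual divisor K - D has degree 2; its rank is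
    rank D - (4 - g + 1) = 1 by Riemann-Roch.  So the proof consists of the part of
    Riemann-Roch that is needed here, [residual_divisor]: if |F| is empty, then
    there is an effective E of degree g - 1 - deg F such that |K - F - E| is
    empty.  [residual_rank] applies it twice.

    Subdivide the curve at finitely many points, including the support of F.  A
    rational function f with F + (f) >= 0 is convex between consecutive points of
    the subdivision, hence its slopes there are at most the floors of the chord
    slopes ([ord_at_le_fdiv]).  Conversely, every real function phi on the
    vertices of the subdivision extends to a rational function whose outgoing
    slopes at the vertices are these floors and which has no poles elsewhere
    ([fdiv_le_ord_at], [ord_at_inner_ge0]).  So |F| is nonempty if and only if some
    phi satisfies, at every vertex v, F(v) + sum of floor((phi(w) - phi(v)) / L)
    >= 0, where the sum is over the segments from v to w and L is the length.  In
    this form a segment that goes to infinity behaves like one of length 1.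

    It remains to prove the duality for this problem on a finite graph,
    [finite_residual].  If F has no effective representative, choose one that is
    maximal in the sense of reduced divisors with respect to a vertex q in debt
    ([maximal_admissible]).  The maximum exists because the floor is upper
    semicontinuous and the potentials are bounded.  By maximality a fire started
    at q burns the whole graph ([maximal_burns]), and the order of burning gives
    an acyclic orientation whose moderator nu, indegree minus 1, dominates the
    representative ([dominated]).  The difference is E.  The divisor K - nu belongs
    to the reversed orientation and has no effective representative, which is
    seen at an extremal vertex of the set where a potential is maximal. *)

(** * Rounding down *)

Section Floor.
Context {R : realType}.
Implicit Types x y : R.

Lemma floorDN_le0 x : Num.floor x + Num.floor (- x) <= 0.
Proof.
rewrite -(ler_int R) intrD mulr0z.
by have := floor_le x; have := floor_le (- x); lra.
Qed.

Lemma floorDN x : Num.floor x + Num.floor (- x) = (x \is a Num.int)%:Z - 1.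
Proof.
rewrite -[Num.floor (- x)]opprK -ceilNfloor ceil_floor; rewrite opprD addrA subrr sub0r.
by case: (_ \is a _).
Qed.

Lemma floorD_le x y : Num.floor x + Num.floor y <= Num.floor (x + y).
Proof. by rewrite floor_ge_int intrD lerD // floor_le. Qed.

Lemma floorD_lt0 x y : x + y <= 0 -> x \isn't a Num.int ->
  Num.floor x + Num.floor y <= -1.
Proof.
move=> xy0; rewrite intrEfloor => xNint.
have x_lt : (Num.floor x)%:~R < x by rewrite lt_neqAle xNint floor_le.
have : (Num.floor x + Num.floor y)%:~R < 0%:~R :> R.
  by rewrite intrD mulr0z; have := floor_le y; lra.
by rewrite ltr_int; lia.
Qed.

Lemma floor_usc x : exists2 d : R, 0 < d & forall e, e <= d ->
  Num.floor (x + e) <= Num.floor x.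
Proof.
exists (((Num.floor x + 1)%:~R - x) / 2) => [|e].
  by have := floorD1_gt x; lra.
move=> e_le; suff : Num.floor (x + e) < Num.floor x + 1 by lia.
by rewrite floor_lt_int; have := floorD1_gt x; lra.
Qed.

Lemma floor_lsc x : exists2 d : R, 0 < d & forall e, e <= d ->
  Num.floor x - (x \is a Num.int)%:Z <= Num.floor (x - e).
Proof.
have [xint|xNint] := boolP (x \is a Num.int).
  exists 1 => // e e1; rewrite floor_ge_int intrB.
  by have := floor_le x; rewrite /=; lra.
exists (x - (Num.floor x)%:~R) => [|e e1].
  by rewrite subr_gt0 lt_neqAle -intrEfloor xNint floor_le.
by rewrite floor_ge_int intrB /=; lra.
Qed.

Lemma finite_pos_min (I : finType) (d : I -> R) : (forall i, 0 < d i) ->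
  exists2 eps : R, 0 < eps & forall i, eps <= d i.
Proof.
move=> d_gt0; suff [eps eps_gt0 H] : exists2 eps : R, 0 < eps &
    forall i, i \in enum I -> eps <= d i.
  by exists eps => // i; apply: H; rewrite mem_enum.
elim: (enum I) => [|i s [eps eps_gt0 H]]; first by exists 1.
exists (Num.min (d i) eps); first by rewrite lt_min d_gt0.
move=> j; rewrite in_cons => /predU1P[->|/H]; rewrite ge_min ?lexx //.
by move=> ->; rewrite orbT.
Qed.

End Floor.

(** * Linear systems on a finite graph *)

Section FiniteGraph.
Context {R : realType} {V E : finType}.
Variables (src tgt : E -> V) (L : E -> R).

(** The sum over the edges that start or end at v, with weights that may depend
    on the direction; a loop contributes both of its weights. *)
Definition star_sum (a b : E -> int) (v : V) : int :=
  \sum_(e | src e == v) a e + \sum_(e | tgt e == v) b e.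

Definition chord (phi : V -> R) (e : E) : R :=
  (phi (tgt e) - phi (src e)) / L e.

(** A potential is a real function on the vertices.  Interpolate it on every edge
    by the largest convex piecewise linear function with integer slopes: its
    outgoing slopes at the two ends are the floors of the two outgoing chord
    slopes, so that [fdiv phi] is the divisor of the interpolation at the
    vertices.  A non-integral chord also leaves one chip inside its edge. *)
Definition fdiv (phi : V -> R) : V -> int :=
  star_sum (fun e => Num.floor (chord phi e))
           (fun e => Num.floor (- chord phi e)).

Lemma sum_star_sum (X : {set V}) a b :
  \sum_(v in X) star_sum a b v =
  \sum_e ((src e \in X)%:Z * a e + (tgt e \in X)%:Z * b e).
Proof.
have sumX (p : E -> V) (c : E -> int) :
    \sum_(v in X) \sum_(e | p e == v) c e = \sum_e (p e \in X)%:Z * c e.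
  transitivity (\sum_(e | p e \in X) c e); last first.
    by rewrite big_mkcond; apply: eq_bigr => e _; case: ifP => _; lia.
  rewrite [RHS](partition_big p (mem X)) //=.
  apply: eq_bigr => v vX; apply: eq_bigl => e.
  by case: eqP => [->|]; rewrite ?vX ?andbT ?andbF.
by rewrite !big_split /= !sumX.
Qed.

Lemma star_sumD a b c d v :
  star_sum a b v + star_sum c d v =
  star_sum (fun e => a e + c e) (fun e => b e + d e) v.
Proof. by rewrite /star_sum !big_split /= addrACA. Qed.

Lemma star_sumN a b v :
  - star_sum a b v = star_sum (fun e => - a e) (fun e => - b e) v.
Proof. by rewrite /star_sum opprD -!sumrN. Qed.

Lemma le_star_sum a b c d v :
  (forall e, src e = v -> a e <= c e) -> (forall e, tgt e = v -> b e <= d e) ->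
  star_sum a b v <= star_sum c d v.
Proof. by move=> ac bd; apply: lerD; apply: ler_sum => e /eqP; auto. Qed.

Hypothesis L_gt0 : forall e, 0 < L e.
Hypothesis loopless : forall e, src e != tgt e.
Hypothesis connX : forall X : {set V}, X != finset.set0 ->
  (forall e, (src e \in X) = (tgt e \in X)) -> X = [set: V].

Lemma common_step (P Q : E -> R -> Prop) :
  (forall e, exists2 d, 0 < d & forall t, t <= d -> P e t) ->
  (forall e, exists2 d, 0 < d & forall t, t <= d -> Q e t) ->
  exists2 eps, 0 < eps & forall e, P e (eps / L e) /\ Q e (eps / L e).
Proof.
move=> Psmall Qsmall.
have [eps eps_gt0 epsPQ] : exists2 eps : R, 0 < eps &
    forall e, eps <= Num.min (projT1 (cid2 (Psmall e))) (projT1 (cid2 (Qsmall e))) * L e.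
  apply: finite_pos_min => e; rewrite mulr_gt0 // lt_min.
  by case: cid2 => ? ? ?; case: cid2 => ? ? ?; apply/andP.
exists eps => // e; move: (epsPQ e); rewrite -ler_pdivrMr // le_min => /andP[].
by case: cid2 => d _ HP /HP HPe; case: cid2 => d' _ HQ /HQ.
Qed.

Lemma chord_lt0 phi e : (chord phi e < 0) = (phi (tgt e) < phi (src e)).
Proof. by rewrite /chord pmulr_llt0 ?invr_gt0 // subr_lt0. Qed.

Lemma chord_gt0 phi e : (0 < chord phi e) = (phi (src e) < phi (tgt e)).
Proof. by rewrite /chord pmulr_lgt0 ?invr_gt0 // subr_gt0. Qed.

Lemma fdiv_shift phi c : fdiv (fun v => phi v - c) =1 fdiv phi.
Proof.
have chordE e : chord (fun v => phi v - c) e = chord phi e.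
  by rewrite /chord; congr (_ / _); ring.
by move=> v; rewrite /fdiv /star_sum;
  congr (_ + _); apply: eq_bigr => e _; rewrite chordE.
Qed.

(** No edge contributes a positive amount to the divisor of a superlevel set,
    and an edge that leaves the set contributes at most minus its drop per unit of
    length.  This bounds the slopes on the boundary of a superlevel set. *)
Lemma level_cut phi e u w : [\/ u = src e /\ w = tgt e | u = tgt e /\ w = src e] ->
  phi w < phi u ->
  (\sum_(x in [set x | phi u <= phi x]) fdiv phi x)%:~R <= (phi w - phi u) / L e.
Proof.
move=> ends wu; rewrite sum_star_sum.
set X := [set _ | _].
pose term e' := (src e' \in X)%:Z * Num.floor (chord phi e') +
  (tgt e' \in X)%:Z * Num.floor (- chord phi e').
have term_le0 e' : term e' <= 0.
  rewrite /term !inE.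
  have := floorDN_le0 (chord phi e').
  case: (leP (phi u) (phi (src e'))) => su;
    case: (leP (phi u) (phi (tgt e'))) => tu; rewrite /= ?mul1r ?mul0r ?addr0 ?add0r // => _.
    rewrite -(ler_int R) (le_trans (floor_le _)) // mulr0z.
    by rewrite ltW // chord_lt0 (lt_le_trans tu).
  rewrite -(ler_int R) (le_trans (floor_le _)) // mulr0z oppr_le0.
  by rewrite ltW // chord_gt0 (lt_le_trans su).
rewrite (bigD1 e) //= -/(term e) intrD.
have : (\sum_(i | i != e) term i) <= 0 by apply: sumr_le0.
rewrite -(ler_int R) mulr0z => rest_le0.
suff : (term e)%:~R <= (phi w - phi u) / L e by lra.
have wX : phi u <= phi w = false by rewrite leNgt wu.
rewrite /term !inE; case: ends => [[uE wE]|[uE wE]]; subst u w.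
  by rewrite lexx wX /= mul1r mul0r addr0; exact: floor_le.
rewrite lexx wX /= mul1r mul0r add0r (le_trans (floor_le _)) //.
by rewrite /chord -mulNr opprB.
Qed.

Section Maximal.
Variables (q : V) (lo : V -> int).

(** For lower bounds [lo] on the divisor away from q, the admissible potentials
    form the analogue of a linear system, normalized by their value at q. *)
Definition admissible (phi : V -> R) : Prop :=
  phi q = 0 /\ forall v, v != q -> lo v <= fdiv phi v.

(** The vertices where the bound exists form a set that contains q and is stable
    along the edges: if u is higher than its neighbour w and than q, then the
    superlevel set of u avoids q, so [level_cut] bounds the drop from u to w. *)
Lemma admissible_bounded v :
  exists C, forall phi, admissible phi -> phi v <= C.
Proof.
pose X := [set v | `[< exists C, forall phi, admissible phi -> phi v <= C >]].
suff XT : X = [set: V] by have := finset.in_setT v; rewrite -XT finset.in_set => /asboolP.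
pose M : int := \sum_v `|lo v|.
have step e u w :
    [\/ u = src e /\ w = tgt e | u = tgt e /\ w = src e] -> w \in X -> u \in X.
  move=> ends; rewrite !finset.in_set => /asboolP[C HC]; apply/asboolP.
  exists (Num.max C 0 + M%:~R * L e) => phi adm.
  have LM0 : 0 <= M%:~R * L e.
    by rewrite mulr_ge0 ?(ltW (L_gt0 _)) // ler0z sumr_ge0.
  have [u0|u0] := leP (phi u) 0.
    by rewrite (le_trans u0) // addr_ge0 // le_max lexx orbT.
  have [uw|wu] := leP (phi u) (phi w).
    rewrite -[phi u]addr0 lerD // (le_trans uw) // le_max HC //.
  have := level_cut ends wu.
  have : - M <= \sum_(x in [set x | phi u <= phi x]) fdiv phi x.
    apply: (@le_trans _ _ (\sum_(x in [set x | phi u <= phi x]) lo x)).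
      rewrite lerNl -sumrN /M big_mkcond /=; apply: ler_sum => x _.
      by case: ifP => // _; lia.
    apply: ler_sum => x; rewrite inE => ux; apply: adm.2.
    by apply: contraTneq ux => ->; rewrite adm.1 -ltNge.
  rewrite -(ler_int R) intrN => H1 H2; have := le_trans H1 H2.
  rewrite ler_pdivlMr // => H; have := HC _ adm.
  by case: (leP C 0); lra.
apply: connX => [|e].
  apply/finset.set0Pn; exists q; rewrite finset.in_set; apply/asboolP.
  by exists 0 => phi [-> _].
by apply/idP/idP; apply: (step e); [right|left].
Qed.

(** The pointwise supremum of the admissible potentials is admissible, because
    the floor is upper semicontinuous.  It plays the role of a reduced divisor. *)
Lemma maximal_admissible phi0 : admissible phi0 ->
  exists2 s, admissible s & forall phi, admissible phi -> forall v, phi v <= s v.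
Proof.
move=> adm0.
pose S v : set R := [set phi v | phi in admissible]%classic.
have hsS v : has_sup (S v).
  split; first by exists (phi0 v), phi0.
  have [C HC] := admissible_bounded v.
  by exists C => _ [phi adm <-]; exact: HC.
pose s v := sup (S v).
have s_ub phi v : admissible phi -> phi v <= s v.
  by move=> adm; apply: sup_upper_bound => //; exists phi.
exists s => [|phi adm v]; last exact: s_ub.
split => [|v vq].
  apply/eqP; rewrite eq_le -{2}adm0.1 s_ub // andbT.
  by apply: ge_sup; [exists (phi0 q), phi0|move=> _ [phi [-> _] <-]].
(* eps is so small that raising any chord by eps / L e does not raise its
   floor; this is what makes the pointwise supremum admissible *)
have [eps eps_gt0 eps_small] := common_step
  (fun e => floor_usc (chord s e)) (fun e => floor_usc (- chord s e)).
have [_ [psi adm <-] psi_gt] := sup_adherent eps_gt0 (hsS v).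
rewrite -/(s v) in psi_gt.
apply: le_trans (adm.2 v vq) _; apply: le_star_sum => e ve.
  have [H _] := eps_small e.
  apply: le_trans H; apply: le_floor; rewrite /chord -mulrDl ler_pM2r ?invr_gt0 //.
  by have := s_ub _ (tgt e) adm; rewrite ve; lra.
have [_ H] := eps_small e.
apply: le_trans H; apply: le_floor; rewrite /chord -!mulNr -mulrDl ler_pM2r ?invr_gt0 //.
by have := s_ub _ (src e) adm; rewrite ve; lra.
Qed.

(** The number of edges with integral chord that join v to the complement of X. *)
Definition int_cut (s : V -> R) (X : {set V}) : V -> int :=
  star_sum (fun e => ((chord s e \is a Num.int) && (tgt e \notin X))%:Z)
           (fun e => ((chord s e \is a Num.int) && (src e \notin X))%:Z).

(** Dhar's burning criterion: if every vertex of X could afford to send a chip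
    along its integral edges leaving X, then raising s slightly on X would give
    a larger admissible potential. *)
Lemma maximal_burns s (X : {set V}) : admissible s ->
  (forall phi, admissible phi -> forall v, phi v <= s v) ->
  X != finset.set0 -> q \notin X ->
  exists2 v, v \in X & fdiv s v < lo v + int_cut s X v.
Proof.
move=> adms smax /finset.set0Pn[v0 v0X] qX; apply: contrapT => noburn.
have H v : v \in X -> lo v <= fdiv s v - int_cut s X v.
  by move=> vX; rewrite leNgt; apply/negP => ?; apply: noburn; exists v => //; lia.
(* eps is so small that lowering a chord by eps / L e only lowers its floor
   when the chord is an integer, and then by 1: raising s by eps on X moves one
   chip along each integral edge leaving X *)
have [eps eps_gt0 eps_small] := common_step
  (fun e => floor_lsc (chord s e)) (fun e => floor_lsc (- chord s e)).
pose phi v := s v + eps * (v \in X)%:R.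
have chordE e : chord phi e =
    chord s e + ((tgt e \in X)%:R - (src e \in X)%:R) * (eps / L e).
  by rewrite /chord /phi; ring.
have eL0 e : 0 <= eps / L e by rewrite divr_ge0 // ltW.
suff /smax/(_ v0) : admissible phi by rewrite /phi v0X mulr1; lra.
split => [|v vq]; first by rewrite /phi (negPf qX) adms.1 mulr0 addr0.
have [vX|vX] := boolP (v \in X); last first.
  apply: le_trans (adms.2 v vq) _; apply: le_star_sum => e ve.
    apply: le_floor; rewrite chordE ve (negPf vX).
    by case: (_ \in X) ; rewrite /= ?subrr ?mul0r ?addr0 // subr0 mul1r lerDl.
  apply: le_floor; rewrite chordE ve (negPf vX).
  by case: (_ \in X) ; rewrite /= ?subrr ?mul0r ?addr0 // sub0r mulN1r opprB lerDr.
apply: le_trans (H _ vX) _; rewrite /fdiv /int_cut star_sumN star_sumD.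
apply: le_star_sum => e ve; rewrite chordE ve vX.
  case: (boolP (tgt e \in X)) => tX; first by rewrite subrr mul0r !addr0 andbF subr0.
  by have [+ _] := eps_small e; rewrite andbT sub0r mulN1r.
case: (boolP (src e \in X)) => tX; first by rewrite subrr mul0r !addr0 andbF subr0.
by have [_] := eps_small e; rewrite andbT subr0 mul1r opprD rpredN.
Qed.

End Maximal.

(** The order in which the vertices burn when the fire starts at q. *)
Lemma removal_order (q : V) (P : {set V} -> V -> Prop) :
  (forall X : {set V}, X != finset.set0 -> q \notin X -> exists2 v, v \in X & P X v) ->
  exists2 pos : V -> nat, injective pos &
    forall v, v != q -> P [set u | (pos v <= pos u)%N] v.
Proof.
move=> pick.
have {}pick n (X : {set V}) : #|X| = n -> q \notin X ->
    exists2 pos : V -> nat, {in X &, injective pos} &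
      forall v, v \in X -> P [set u in X | (pos v <= pos u)%N] v.
  elim: n X => [|n IH] X.
    move/eqP; rewrite cards_eq0 => /eqP-> _.
    by exists (fun=> 0%N) => v; rewrite inE.
  move=> cX qX.
  have X0 : X != finset.set0 by rewrite -cards_eq0 cX.
  have [v0 v0X Pv0] := pick X X0 qX.
  have [||pos pos_inj posP] := IH (X :\ v0).
  - by have := cardsD1 v0 X; rewrite cX v0X; lia.
  - by rewrite !inE negb_and qX orbT.
  exists (fun u => if u == v0 then 0%N else (pos u).+1).
    move=> u w uX wX; case: eqVneq => [->|uv]; case: eqVneq => [->|wv] //.
    by move=> [ouw]; apply: pos_inj; rewrite ?inE ?uv ?wv.
  move=> v vX; case: eqVneq => [->|vv0].
    by rewrite (_ : [set _ in X | _] = X) //; apply/setP => u; rewrite !inE andbT.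
  have /posP : v \in X :\ v0 by rewrite !inE vv0.
  congr (P _ _); apply/setP => u; rewrite !inE.
  by case: eqVneq => [->|] //=; rewrite ?andbF.
have [||pos pos_inj posP] := pick #|[set~ q]| [set~ q].
- by [].
- by rewrite !inE eqxx.
exists (fun u => if u == q then 0%N else (pos u).+1).
  move=> u w; case: eqVneq => [->|uv]; case: eqVneq => [->|wv] //.
  by move=> [ouw]; apply: pos_inj; rewrite ?inE.
move=> v vq; rewrite (negPf vq).
have /posP : v \in [set~ q] by rewrite !inE.
by congr (P _ _); apply/setP => u; rewrite !inE; case: eqVneq.
Qed.

(** Orient every edge with integral chord by increasing [pos], and let the edges
    with non-integral chord point to a new vertex in their middle.  Then
    [early s pos v] is the indegree of v in this acyclic orientation, and
    [early s pos v - 1] its value under the associated moderator divisor. *)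
Definition early (s : V -> R) (pos : V -> nat) : V -> int :=
  star_sum (fun e => ((chord s e \is a Num.int) && (pos (tgt e) < pos (src e))%N)%:Z)
           (fun e => ((chord s e \is a Num.int) && (pos (src e) < pos (tgt e))%N)%:Z).

(** A divisor without effective representative is equivalent to one that is
    dominated by a moderator.  The potential phi0 has minimal total debt; q is a
    vertex in debt, and the maximal potential among those that create no new
    debt away from q leaves q in debt, by minimality.  Burning from q gives the
    order. *)
Lemma dominated (F : V -> int) :
  (forall phi, ~ forall v, 0 <= F v + fdiv phi v) ->
  exists s (pos : V -> nat), injective pos /\
    forall v, F v + fdiv s v <= early s pos v - 1.
Proof.
move=> noeff.
pose debt phi : nat := (\sum_v absz (Num.min 0 (F v + fdiv phi v))%R)%N.
have [phi0 phi0_min] : exists phi0, forall phi, (debt phi0 <= debt phi)%N.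
  have ex : exists n, `[< exists phi, debt phi = n >].
    by exists (debt (fun=> 0)); apply/asboolP; exists (fun=> 0).
  case: (ex_minnP ex) => n /asboolP[phi0 <-] nmin.
  by exists phi0 => phi; apply: nmin; apply/asboolP; exists phi.
have [q q_debt] : exists q, F q + fdiv phi0 q < 0.
  apply: contrapT => noq; apply: (noeff phi0) => v.
  by rewrite leNgt; apply/negP => ?; apply: noq; exists v.
pose lo v := Num.min 0 (F v + fdiv phi0 v) - F v.
have adm0 : admissible q lo (fun v => phi0 v - phi0 q).
  by split=> [|u _]; rewrite ?subrr // fdiv_shift /lo; lia.
have [s adms smax] := maximal_admissible adm0.
have [pos pos_inj posP] := removal_order (fun X => maximal_burns adms smax (X := X)).
exists s, pos; split=> // v; have [->|vq] := eqVneq v q; last first.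
  have := posP v vq.
  have -> : int_cut s [set u | (pos v <= pos u)%N] v = early s pos v.
    by congr (_ + _); apply: eq_bigr => e /eqP <-; rewrite !inE -ltnNge.
  by rewrite /lo; lia.
have early_ge0 : 0 <= early s pos q.
  by apply: addr_ge0; apply: sumr_ge0.
suff : F q + fdiv s q < 0 by lia.
have := phi0_min s; rewrite /debt (bigD1 q) //= [leqRHS](bigD1 q) //=.
have : (\sum_(i | i != q) absz (Num.min 0 (F i + fdiv s i))%R <=
        \sum_(i | i != q) absz (Num.min 0 (F i + fdiv phi0 i))%R)%N.
  by apply: leq_sum => u uq; have := adms.2 u uq; rewrite /lo; lia.
by lia.
Qed.

(** The finite form of Riemann-Roch.  With nu the moderator of [dominated], take
    E' to be nu minus the representative of F.  So K - F - E' is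
    equivalent to K - nu, the moderator of the reversed orientation.  Whatever
    potential is applied to K - nu, the result is negative at the last vertex, in
    the order [pos], among those where this potential is maximal. *)
Theorem finite_residual (F : V -> int) :
  (forall phi, ~ forall v, 0 <= F v + fdiv phi v) ->
  exists E' : V -> int,
    [/\ forall v, 0 <= E' v,
        \sum_v E' v = #|E|%:Z - #|V|%:Z - \sum_v F v &
        forall psi, ~ forall v,
          0 <= star_sum (fun=> 1) (fun=> 1) v - 2 - F v - E' v + fdiv psi v].
Proof.
move=> noeff; have [v0 _] : exists v : V, True.
  by apply: contrapT => noV; apply: (noeff (fun=> 0)) => v; case: noV; exists v.
have [s [pos [pos_inj dom]]] := dominated noeff.
have neq_pos e : pos (src e) != pos (tgt e) by rewrite (inj_eq pos_inj).
exists (fun v => early s pos v - 1 - (F v + fdiv s v)); split => [v||psi effpsi].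
- by have := dom v; lia.
- transitivity (\sum_v (early s pos v - fdiv s v) - #|V|%:Z - \sum_v F v).
    transitivity (\sum_v (early s pos v - fdiv s v - 1 - F v)).
      by apply: eq_bigr => v _; lia.
    by rewrite !sumrB sumr_const natz.
  congr (_ - _ - _).
  transitivity (\sum_(v in [set: V]) (early s pos v - fdiv s v)).
    by apply: eq_bigl => v; rewrite inE.
  under eq_bigr do rewrite star_sumN star_sumD.
  rewrite sum_star_sum; transitivity (\sum_(e : E) (1 : int)); last first.
    by rewrite sumr_const natz.
  apply: eq_bigr => e _; rewrite !inE !mul1r.
  have := floorDN (chord s e); have := neq_pos e.
  by case: (_ \is a _); lia.
- pose chi v := s v + psi v.
  have chordD e : chord chi e = chord s e + chord psi e.
    by rewrite /chord /chi; ring.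
  (* v is the last vertex, in the order pos, among the maximizers of chi *)
  have [v1 _ v1_max] := @arg_maxP _ _ _ v0 xpredT chi isT.
  have [v /eqP v_top v_last] := @arg_maxnP _ v1 (fun u => chi u == chi v1) pos (eqxx _).
  have v_max w : chi w <= chi v by rewrite v_top; exact: v1_max.
  have v_later w : (pos v < pos w)%N -> chi w < chi v.
    rewrite ltnNge lt_neqAle v_max andbT v_top; apply: contraNneq => chiw.
    by apply: v_last; apply/eqP.
  have le0 (x y : R) (b : bool) : x + y <= 0 -> (~~ b -> x + y < 0) ->
      1 - ((x \is a Num.int) && b)%:Z + (Num.floor x + Num.floor y) <= 0.
    move=> xy0 xyN; have [xint|xNint] := boolP (x \is a Num.int) => /=; last first.
      by have := floorD_lt0 xy0 xNint; lia.
    have := floorD_le x y; case: b xyN => /= [_|/(_ isT) xy_lt0].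
      by have : Num.floor (x + y) <= Num.floor (0 : R) := le_floor xy0; rewrite floor0; lia.
    by have : Num.floor (x + y) < 0; [rewrite floor_lt0|lia].
  suff : star_sum (fun=> 1) (fun=> 1) v - early s pos v + (fdiv s v + fdiv psi v) <= 0.
    by have := effpsi v; lia.
  rewrite star_sumN star_sumD star_sumD star_sumD.
  apply: (@le_trans _ _ (star_sum (fun=> 0) (fun=> 0) v)); last first.
    by rewrite /star_sum !big1.
  apply: le_star_sum => e ve.
    apply: le0; rewrite -chordD.
      by rewrite leNgt chord_gt0 -leNgt ve.
    rewrite -leqNgt chord_lt0 leq_eqVlt (negPf (neq_pos e)) /= ve; exact: v_later.
  rewrite -[chord s e \is a _]rpredN; apply: le0; rewrite -opprD -chordD.
    by rewrite oppr_le0 leNgt chord_lt0 -leNgt ve.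
  rewrite -leqNgt oppr_lt0 chord_gt0 leq_eqVlt eq_sym (negPf (neq_pos e)) /= ve.
  exact: v_later.
Qed.

End FiniteGraph.

(** * Piecewise affine functions *)

Section Affine.
Context {R : realType}.
Implicit Types (a b t x y L : \bar R) (h : \bar R -> \bar R) (s : seq (\bar R)).

Lemma ereal_between a b : (a < b)%E -> exists x : R, (a < x%:E < b)%E.
Proof.
case: a b => [a| |] [b| |] //.
- rewrite lte_fin => ab; exists ((a + b) / 2); rewrite !lte_fin.
  by apply/andP; split; lra.
- by move=> _; exists (a + 1); rewrite lte_fin ltry andbT; lra.
- by move=> _; exists (b - 1); rewrite lte_fin ltNyr /=; lra.
- by move=> _; exists 0; rewrite ltNyr ltry.
Qed.

Lemma affine_onW h a b a' b' m : (a <= a')%E -> (b' <= b)%E ->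
  affine_on h a b m -> affine_on h a' b' m.
Proof.
by move=> aa bb H x y /andP[ax xb] /andP[ay yb]; apply: H;
  rewrite (le_lt_trans aa) ?(lt_le_trans _ bb).
Qed.

Lemma affine_on_uniq h a b m n : (a < b)%E ->
  affine_on h a b m -> affine_on h a b n -> m = n.
Proof.
move=> /ereal_between[x /andP[ax xb]] hm hn.
have [y /andP[xy yb]] := ereal_between xb.
have xab : (a < x%:E < b)%E by rewrite ax.
have yab : (a < y%:E < b)%E by rewrite (lt_trans ax).
rewrite lte_fin in xy; have [hx hy] := hm _ _ xab yab; have [_] := hn _ _ xab yab; rewrite hy.
rewrite -(fineK hx) -!EFinD => -[] /addrI /eqP.
rewrite -subr_eq0 -mulrBl mulf_eq0 !subr_eq0 (gt_eqF xy) orbF eqr_int.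
by move/eqP.
Qed.

Lemma path_lt_last x s : path (fun x y => (x < y)%E) x s -> (x <= last x s)%E.
Proof.
elim: s x => [|y s IH] x //= /andP[xy /IH]; exact/le_trans/ltW.
Qed.

Definition affine_pieces h x s := forall i, (i < size s)%N ->
  exists m : int, affine_on h (nth 0%E (x :: s) i) (nth 0%E s i) m.

Lemma piece_fwd h x s t : path (fun x y => (x < y)%E) x s ->
  affine_pieces h x s -> (x <= t < last x s)%E ->
  exists a b m, [/\ (x <= a <= t)%E, (t < b <= last x s)%E, a \in x :: s &
    affine_on h a b m].
Proof.
elim: s x => [|y s IH] x /=.
  by move=> _ _ /andP[/le_lt_trans H /H]; rewrite ltxx.
move=> /andP[xy ys] hs /andP[xt tL]; have [ty|yt] := ltP t y.
  have [m hm] := hs 0%N isT; exists x, y, m.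
  by rewrite lexx xt ty path_lt_last // mem_head.
have [|||a [b [m [/andP[ya at_] tb asy hm]]]] := IH y => //.
- by move=> i; apply: (hs i.+1).
- by rewrite yt.
exists a, b, m; split => //; last by rewrite in_cons asy orbT.
by rewrite at_ andbT (le_trans (ltW xy)).
Qed.

Lemma piece_bwd h x s t : path (fun x y => (x < y)%E) x s ->
  affine_pieces h x s -> (x < t <= last x s)%E ->
  exists a m, (x <= a < t)%E /\ affine_on h a t m.
Proof.
elim: s x => [|y s IH] x /=.
  by move=> _ _ /andP[/lt_le_trans H /H]; rewrite ltxx.
move=> /andP[xy ys] hs /andP[xt tL]; have [ty|yt] := leP t y.
  have [m hm] := hs 0%N isT; exists x, m; split; first by rewrite lexx.
  exact: affine_onW hm.
have [||| a [m [/andP[ya at_] hm]]] := IH y => //.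
- by move=> i; apply: (hs i.+1).
- by rewrite yt.
by exists a, m; split => //; rewrite at_ andbT (le_trans (ltW xy)).
Qed.

(** To prove piecewise linearity it suffices to continue to the right of every
    point as an affine function, up to a point of a finite list: the breakpoints
    are found one after the other, and the part of the list that lies to the
    right gets smaller. *)
Lemma piecewise_linear_ends L h (bs : seq (\bar R)) : (0 < L)%E ->
  (forall t, (0 <= t < L)%E -> exists b m,
    [/\ b \in bs, (t < b <= L)%E & affine_on h t b m]) ->
  piecewise_linear L h.
Proof.
move=> L_gt0 H.
suff chain t : (0 <= t < L)%E -> exists s,
    [/\ path (fun x y => (x < y)%E) t s, last t s = L & affine_pieces h t s].
  by have [|s [? ? ?]] := chain 0%E; [rewrite lexx|exists s].
have [n] := ubnP (count (fun b => (t < b)%E) bs).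
elim: n t => // n IH t; rewrite ltnS => tn tL.
have [b [m [bbs /andP[tb bL] hm]]] := H t tL.
have t_ge0 : (0 <= t)%E by case/andP: tL.
have single : affine_pieces h t [:: b] by case=> // _; exists m.
have [bL'|Lb] := ltP b L; last first.
  exists [:: b]; split => //=; first by rewrite tb.
  by apply/eqP; rewrite eq_le bL.
have [||s [sp sL hs]] := IH b.
- apply: leq_trans tn; rewrite -!size_filter.
  have -> : [seq x <- bs | (b < x)%E] = [seq x <- [seq x <- bs | (t < x)%E] | (b < x)%E].
    rewrite -filter_predI; apply: eq_filter => x /=.
    by apply/idP/andP => [bx|[]//]; rewrite (lt_trans tb).
  rewrite [ltnLHS]size_filter -(count_predC (fun x => (b < x)%E) [seq x <- bs | (t < x)%E]).
  rewrite -[ltnLHS]addn0 ltn_add2l -has_count; apply/hasP; exists b => /=.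
    by rewrite mem_filter tb.
  by rewrite ltxx.
- by rewrite bL' (le_trans t_ge0) // ltW.
exists (b :: s); split => //=; first by rewrite tb.
by case=> [|i] /= i_lt; [exists m|exact: hs].
Qed.

Context {G : tropical_curve R}.
Implicit Types (f : tpoint G -> \bar R) (e : edge G).

Lemma fwd_slopeE f e t b m : (t < b <= len e)%E ->
  affine_on (f \o edge_point e) t b m -> fwd_slope f e t = m.
Proof.
move=> tb hm; apply: xget_unique; first by exists b.
move=> n [b' [/andP[tb' _] hn]]; have /andP[tb1 _] := tb.
apply: (@affine_on_uniq (f \o edge_point e) t (Order.min b b')).
- by rewrite lt_min tb1.
- by apply: affine_onW hn => //; rewrite ge_min lexx orbT.
- by apply: affine_onW hm => //; rewrite ge_min lexx.
Qed.

Lemma bwd_slopeE f e t a m : (0 <= a < t)%E ->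
  affine_on (f \o edge_point e) a t m -> bwd_slope f e t = - m.
Proof.
move=> ta hm; congr (- _); apply: xget_unique; first by exists a.
move=> n [a' [/andP[_ ta'] hn]]; have /andP[_ ta1] := ta.
apply: (@affine_on_uniq (f \o edge_point e) (Order.max a a') t).
- by rewrite gt_max ta1.
- by apply: affine_onW hn => //; rewrite le_max lexx orbT.
- by apply: affine_onW hm => //; rewrite le_max lexx.
Qed.

Lemma fwd_slopeP f e t : piecewise_linear (len e) (f \o edge_point e) ->
  (0 <= t < len e)%E -> exists2 b, (t < b <= len e)%E &
    affine_on (f \o edge_point e) t b (fwd_slope f e t).
Proof.
move=> [s [sp sL hs]] te; rewrite -sL in te.
have [a [b [m [/andP[_ at_] tb _ hm]]]] := piece_fwd sp hs te.
rewrite sL in tb; have hm' := affine_onW at_ (lexx b) hm.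
by exists b => //; rewrite (fwd_slopeE tb hm').
Qed.

Lemma bwd_slopeP f e t : piecewise_linear (len e) (f \o edge_point e) ->
  (0 < t <= len e)%E -> exists2 a, (0 <= a < t)%E &
    affine_on (f \o edge_point e) a t (- bwd_slope f e t).
Proof.
move=> [s [sp sL hs]] te; rewrite -sL in te.
have [a [m [ta hm]]] := piece_bwd sp hs te.
by exists a => //; rewrite (bwd_slopeE ta hm) opprK.
Qed.

Lemma edge_point_inner (p : {p : edge G * R | is_inner p}) :
  edge_point (val p).1 (val p).2%:E = inr p.
Proof. by rewrite /edge_point -surjective_pairing valK. Qed.

Lemma ord_at_finite_support f :
  (forall e, piecewise_linear (len e) (f \o edge_point e)) ->
  exists r : seq (tpoint G), forall P, P \notin r -> ord_at f P = 0.
Proof.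
move=> /choice[s Hs].
exists ([seq inl v | v <- enum (vertex G)] ++
        flatten [seq [seq edge_point e x | x <- s e] | e <- enum (edge G)]).
case=> [v|p]; rewrite mem_cat negb_or.
  by case/andP => + _; rewrite map_f // mem_enum.
case/andP => _ /flattenP pr; rewrite /ord_at.
have := edge_point_inner p; have := valP p; rewrite /is_inner.
case: (val p) => e t /= /andP[t_gt0 t_lt] ptE.
have [sp sL hs] := Hs e.
have te : (0 <= t%:E < last 0%E (s e))%E by rewrite sL lee_fin ltW.
have [a [b [m [/andP[a_ge0 at_] tb ae hm]]]] := piece_fwd sp hs te.
have at' : (a < t%:E)%E.
  rewrite lt_neqAle at_ andbT; apply/negP => /eqP aE; subst a; apply: pr.
  exists [seq edge_point e x | x <- s e].
    by apply/mapP; exists e; rewrite ?mem_enum.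
  move: ae; rewrite inE => /predU1P[a0|ae].
    by move: t_gt0; rewrite -lte_fin a0 ltxx.
  by apply/mapP; exists t%:E.
rewrite sL in tb; rewrite (fwd_slopeE tb (affine_onW at_ (lexx b) hm)).
rewrite (bwd_slopeE _ (affine_onW (lexx a) _ hm)) ?subrr ?a_ge0 //.
by case/andP: tb => /ltW.
Qed.

(** Piecewise linearity makes the sum that defines [divisor_of f] finite. *)
Lemma coeff_divisor_of f P :
  (forall e, piecewise_linear (len e) (f \o edge_point e)) ->
  coeff P (divisor_of f) = ord_at f P.
Proof.
move=> /ord_at_finite_support[r Hr].
rewrite /divisor_of (fsbigE (undup (P :: r))) ?undup_uniq //; last first.
  move=> Q _; rewrite mem_undup inE negb_or => /andP[_ /Hr ->].
  by rewrite freegU0.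
rewrite (eq_bigl xpredT) => [|Q]; last by rewrite in_setT.
rewrite raddf_sum (bigD1_seq P) ?undup_uniq ?mem_undup ?mem_head //=.
rewrite coeffU eqxx mulr1 big1 ?addr0 // => Q QP.
by rewrite coeffU (negPf QP) mulr0.
Qed.

End Affine.

(** * Subdivisions of a tropical curve *)

Section Model.
Context {R : realType} {G : tropical_curve R}.

(** A point at infinity lies on no other edge, so only the edge of infinite
    length that ends there has to be considered near it. *)
Lemma valence1_uniq (v : vertex G) (e e' : edge G) : valence v = 1%N ->
  etgt e = v -> esrc e' != v /\ (etgt e' = v -> e' = e).
Proof.
move=> val1 ev; have e_in : e \in [set x | etgt x == v]%SET by rewrite !inE ev.
have : (0 < #|[set x | etgt x == v]%SET|)%N by rewrite (cardD1 e) e_in.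
move: val1; rewrite /valence => val1 tgt_gt0; split.
  apply/negP => e'v.
  have : (0 < #|[set x | esrc x == v]%SET|)%N by rewrite (cardD1 e') !inE e'v.
  by lia.
move=> e'v; have /card_le1_eqP : (#|[set x | etgt x == v]%SET| <= 1)%N by lia.
by apply=> //; rewrite !inE e'v.
Qed.

Lemma esrc_not_infty (e e' : edge G) : len e = +oo%E -> esrc e' != etgt e.
Proof. by move=> /len_infty val1; have [] := valence1_uniq e' val1 erefl. Qed.

Lemma etgt_infty (e e' : edge G) : len e = +oo%E -> etgt e' = etgt e -> e' = e.
Proof. by move=> /len_infty val1; have [_] := valence1_uniq e' val1 erefl. Qed.

Variable s : seq {p : edge G * R | is_inner p}.

(* The inner points of s subdivide the curve.  A segment is named by the point
   where it starts: an edge of G stands for its first segment, and a point of s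
   for the segment that follows it on its edge. *)
Notation bpt := (seq_sub s).
Definition mvertex : finType := (vertex G + bpt)%type.
Definition segment : finType := (edge G + bpt)%type.

Definition bedge (p : bpt) : edge G := (val (ssval p)).1.
Definition bpos (p : bpt) : R := (val (ssval p)).2.

Lemma bpos_gt0 p : 0 < bpos p.
Proof. by have /andP[] := valP (ssval p). Qed.

Lemma bpos_lt p : ((bpos p)%:E < len (bedge p))%E.
Proof. by have /andP[] := valP (ssval p). Qed.

Lemma bpt_inj p q : bedge p = bedge q -> bpos p = bpos q -> p = q.
Proof.
move=> pq1 pq2; apply: val_inj; apply: val_inj.
by rewrite [LHS]surjective_pairing [RHS]surjective_pairing; congr pair.
Qed.

Definition mpoint (v : mvertex) : tpoint G :=
  match v with inl u => inl u | inr p => inr (ssval p) end.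

Lemma mpoint_inj : injective mpoint.
Proof. by move=> [u|p] [u'|p'] //= [] => [->|/val_inj->]. Qed.

Definition sedge (x : segment) : edge G :=
  match x with inl e => e | inr p => bedge p end.
Definition sstart (x : segment) : R :=
  match x with inl e => 0 | inr p => bpos p end.
Definition ssrc (x : segment) : mvertex :=
  match x with inl e => inl (esrc e) | inr p => inr p end.

(** The segment that follows x; the last segment of an edge is followed by the
    first one.  This makes [snext] a permutation of the segments, so that a sum
    over the segments that end at a vertex can be reindexed by [snext]. *)
Definition snext (x : segment) : segment :=
  if [pick p | [&& bedge p == sedge x, sstart x < bpos p &
      [forall q, (bedge q == sedge x) && (sstart x < bpos q) ==>
         (bpos p <= bpos q)]]] is Some p then inr p else inl (sedge x).

(** The end of the segment that precedes y, as a parameter; [endvertex] gives it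
    as a vertex. *)
Definition endpos (y : segment) : \bar R :=
  match y with inl e => len e | inr p => (bpos p)%:E end.
Definition endvertex (y : segment) : mvertex :=
  match y with inl e => inl (etgt e) | inr p => inr p end.
Definition send (x : segment) : \bar R := endpos (snext x).
Definition stgt (x : segment) : mvertex := endvertex (snext x).

Variant snext_spec (x : segment) : segment -> Type :=
| SnextInner p of bedge p = sedge x & sstart x < bpos p &
    (forall q, bedge q = sedge x -> sstart x < bpos q -> bpos p <= bpos q) :
    snext_spec x (inr p)
| SnextLast of (forall q, bedge q = sedge x -> bpos q <= sstart x) :
    snext_spec x (inl (sedge x)).

Lemma snextP x : snext_spec x (snext x).
Proof.
rewrite /snext; case: pickP => [p /and3P[/eqP pe xp /forallP pmin]|nop].
  constructor=> // q /eqP qe xq.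
  by have /implyP := pmin q; apply; rewrite qe.
constructor => q qe; rewrite leNgt; apply/negP => xq.
have qP : (bedge q == sedge x) && (sstart x < bpos q) by rewrite qe eqxx.
have [p /andP[pe xp] pmin] := @arg_minP _ _ _ q
  (fun p => (bedge p == sedge x) && (sstart x < bpos p)) bpos qP.
have := nop p; rewrite pe xp /=; move/forallP; apply => r.
by apply/implyP => /pmin.
Qed.

Lemma sedge_next x : sedge (snext x) = sedge x.
Proof. by case: snextP. Qed.

Lemma sstart_ge0 x : 0 <= sstart x.
Proof. by case: x => //= p; rewrite ltW ?bpos_gt0. Qed.

Lemma sstart_lt_len x : ((sstart x)%:E < len (sedge x))%E.
Proof. by case: x => [e|p] /=; [exact: len_gt0|exact: bpos_lt]. Qed.

Lemma sstart_lt_send x : ((sstart x)%:E < send x)%E.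
Proof. by rewrite /send; case: snextP => //= _; exact: sstart_lt_len. Qed.

Lemma send_le_len x : (send x <= len (sedge x))%E.
Proof.
by rewrite /send; case: snextP => //= p <- _ _; exact/ltW/bpos_lt.
Qed.

Lemma send_le_bpos x q :
  bedge q = sedge x -> sstart x < bpos q -> (send x <= (bpos q)%:E)%E.
Proof.
rewrite /send; case: snextP => /= [p _ _ H qe xq|H /H]; first by rewrite lee_fin H.
by rewrite leNgt => /negP.
Qed.

Lemma segment_inj x y : sedge x = sedge y -> sstart x = sstart y -> x = y.
Proof.
case: x y => [e|p] [e'|p'] //=; first by move=> ->.
- by move=> _ p0; have := bpos_gt0 p'; rewrite -p0 ltxx.
- by move=> _ p0; have := bpos_gt0 p; rewrite p0 ltxx.
- by move=> ee pp; rewrite (bpt_inj ee pp).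
Qed.

Lemma sstart_lt_le x y : sedge x = sedge y -> sstart x < sstart y ->
  (send x <= (sstart y)%:E)%E.
Proof.
case: y => [e|q] xy /= xlt; last exact: send_le_bpos.
by have := sstart_ge0 x; rewrite leNgt xlt.
Qed.

Lemma snext_inj : injective snext.
Proof.
suff lt_contra x y : snext x = snext y -> ~ sstart x < sstart y.
  move=> x y xy; apply: segment_inj; first by rewrite -sedge_next xy sedge_next.
  by case: (ltgtP (sstart x) (sstart y)) => // /lt_contra; case.
move=> xy xlty.
have xyE : sedge x = sedge y by rewrite -sedge_next xy sedge_next.
have := sstart_lt_le xyE xlty.
by rewrite /send xy leNgt => /negP; apply; exact: sstart_lt_send.
Qed.

Lemma segment_uniq x y (t : \bar R) : sedge x = sedge y ->
  ((sstart x)%:E <= t < send x)%E -> ((sstart y)%:E <= t < send y)%E -> x = y.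
Proof.
move=> xy /andP[xt tx] /andP[yt ty]; apply: segment_inj => //.
case: (ltgtP (sstart x) (sstart y)) => // lt_xy; exfalso.
  have := sstart_lt_le xy lt_xy.
  by rewrite leNgt (le_lt_trans yt tx).
have := sstart_lt_le (esym xy) lt_xy.
by rewrite leNgt (le_lt_trans xt ty).
Qed.

(** The segment that contains t has the largest start among those starting at or
    before t. *)
Lemma segment_cover e (t : R) : 0 <= t -> (t%:E < len e)%E ->
  exists x, sedge x = e /\ ((sstart x)%:E <= t%:E < send x)%E.
Proof.
move=> t0 te.
have e0 : (sedge (inl e) == e) && (sstart (inl e) <= t) by rewrite /= eqxx.
have [x /andP[/eqP xe xt] xmax] := @arg_maxP _ _ _ (inl e : segment)
  (fun x => (sedge x == e) && (sstart x <= t)) sstart e0.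
exists x; split => //; rewrite lee_fin xt /=.
rewrite /send; case: snextP => [p pe xp _|_] /=; last by rewrite xe.
rewrite lte_fin ltNge; apply/negP => pt.
have : (sedge (inr p) == e) && (sstart (inr p) <= t) by rewrite /= pe xe eqxx.
by move=> /xmax /=; lra.
Qed.

Lemma segment_cover_right e (t : R) : 0 < t -> (t%:E <= len e)%E ->
  exists x, sedge x = e /\ ((sstart x)%:E < t%:E <= send x)%E.
Proof.
move=> t0 te.
have e0 : (sedge (inl e) == e) && (sstart (inl e) < t) by rewrite /= eqxx.
have [x /andP[/eqP xe xt] xmax] := @arg_maxP _ _ _ (inl e : segment)
  (fun x => (sedge x == e) && (sstart x < t)) sstart e0.
exists x; split => //; rewrite lte_fin xt /=.
rewrite /send; case: snextP => [p pe xp _|_] /=; last by rewrite xe.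
rewrite lee_fin leNgt; apply/negP => pt.
have : (sedge (inr p) == e) && (sstart (inr p) < t) by rewrite /= pe xe eqxx.
by move=> /xmax /=; lra.
Qed.

Lemma edge_point_bpt p : edge_point (bedge p) (bpos p)%:E = inr (ssval p).
Proof. exact: edge_point_inner. Qed.

Lemma edge_point0 (e : edge G) : edge_point e 0%E = inl (esrc e).
Proof.
rewrite /edge_point /= insubN; last by rewrite /is_inner /= ltxx.
by rewrite lexx.
Qed.

Lemma edge_point_len (e : edge G) : edge_point e (len e) = inl (etgt e).
Proof.
have := len_gt0 e; case re: (len e) => [r| |] //= r0.
rewrite insubN; last by rewrite /is_inner /= re ltxx andbF.
by rewrite leNgt -lte_fin r0.
Qed.

Lemma edge_point_sstart x : edge_point (sedge x) (sstart x)%:E = mpoint (ssrc x).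
Proof. by case: x => [e|p] /=; [exact: edge_point0|exact: edge_point_bpt]. Qed.

Lemma edge_point_send x : edge_point (sedge x) (send x) = mpoint (stgt x).
Proof.
rewrite /send /stgt; case: snextP => [p <- _ _|_] /=.
  exact: edge_point_bpt.
exact: edge_point_len.
Qed.

Lemma send_infty x : send x = +oo%E ->
  len (sedge x) = +oo%E /\ stgt x = inl (etgt (sedge x)).
Proof. by rewrite /send /stgt; case: snextP. Qed.

Lemma send_infty_uniq (x y : segment) : send y = +oo%E -> stgt x = stgt y -> x = y.
Proof.
move=> yoo; have [leny] := send_infty yoo; rewrite /stgt => ->.
case xE: (snext x) / (snextP x) => [//|_] [] /(etgt_infty leny) xy.
apply: snext_inj; rewrite xE xy.
by move: yoo; rewrite /send; case: snextP.
Qed.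

Lemma ssrc_not_infty (x y : segment) : send y = +oo%E -> stgt y != ssrc x.
Proof.
move=> yoo; have [leny ->] := send_infty yoo.
case: x => [e|//] /=; apply/eqP => -[] /eqP.
by rewrite eq_sym (negPf (esrc_not_infty e leny)).
Qed.

(** The segments at a vertex are the directions at this point of the curve. *)
Lemma star_sum_segments (g : edge G -> \bar R -> int) (h : edge G -> \bar R -> int) v :
  star_sum ssrc stgt (fun x => g (sedge x) (sstart x)%:E)
                     (fun x => h (sedge x) (send x)) v =
  match v with
  | inl u => \sum_(e | esrc e == u) g e 0%E + \sum_(e | etgt e == u) h e (len e)
  | inr p => g (bedge p) (bpos p)%:E + h (bedge p) (bpos p)%:E
  end.
Proof.
rewrite /star_sum.
have -> : \sum_(x | stgt x == v) h (sedge x) (send x) =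
          \sum_(y | endvertex y == v) h (sedge y) (endpos y).
  rewrite [RHS](reindex_inj snext_inj) /=.
  by apply: eq_bigr => x _; rewrite sedge_next.
rewrite !big_sumType /=; case: v => [u|p].
  rewrite [X in _ + X + _]big1 ?addr0 //; congr (_ + _).
  by rewrite [X in _ + X]big1 ?addr0.
rewrite [X in X + _ + _]big1 // add0r [X in _ + (X + _)]big1 // add0r.
by congr (_ + _); rewrite (big_pred1 p).
Qed.

Lemma ord_at_mpoint (f : tpoint G -> \bar R) v :
  ord_at f (mpoint v) =
  star_sum ssrc stgt (fun x => fwd_slope f (sedge x) (sstart x)%:E)
                     (fun x => bwd_slope f (sedge x) (send x)) v.
Proof.
rewrite (star_sum_segments (fwd_slope f) (bwd_slope f)).
case: v => [u|p] //=.
by rewrite /bedge /bpos; case: (ssval p) => -[e t].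
Qed.

Lemma card_segment : #|segment|%:Z - #|mvertex|%:Z = genus G - 1.
Proof. by rewrite !card_sum /genus; lia. Qed.

(** A segment of infinite length is given the length 1.  Only the slope on such a
    segment matters, and its point at infinity, which has no other segment, may
    be given any potential. *)
Definition slen (x : segment) : R :=
  if send x is r%:E then r - sstart x else 1.

Lemma slen_gt0 x : 0 < slen x.
Proof.
rewrite /slen; have := sstart_lt_send x; case: (send x) => //= r.
by rewrite lte_fin subr_gt0.
Qed.

Hypothesis s_meets : forall e, exists p : bpt, bedge p = e.

Lemma segment_loopless x : ssrc x != stgt x.
Proof.
rewrite /stgt; case: snextP => [p pe xp _|H] /=.
  case: x pe xp => [//|q] /= _; apply: contraTneq => -[->].
  by rewrite ltxx.
case: x H => [e|//] /= H; have [p pe] := s_meets e.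
by have := H p pe; rewrite leNgt bpos_gt0.
Qed.

Lemma model_connected (X : {set mvertex}) : X != finset.set0 ->
  (forall x, (ssrc x \in X) = (stgt x \in X)) -> X = [set: mvertex].
Proof.
move=> /finset.set0Pn[v0 v0X] clX.
have along x : (ssrc x \in X) = (inl (etgt (sedge x)) \in X).
  pose after (x : segment) := [set p : bpt | (bedge p == sedge x) && (sstart x < bpos p)]%SET.
  have [n] := ubnP #|after x|; elim: n x => // n IH x; rewrite ltnS => xn.
  rewrite clX /stgt; case: snextP => [p pe xp pmin|_] //=.
  have -> : sedge x = sedge (inr p) by rewrite /= pe.
  apply: (IH (inr p)); apply: leq_trans xn; apply: proper_card.
  apply/properP; split.
    apply/fintype.subsetP => q; rewrite !inE /= pe => /andP[-> pq] /=; exact: lt_trans pq.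
  by exists p; rewrite !inE /= ?pe ?eqxx ?ltxx.
have edgeX (e : edge G) : ((inl (esrc e) : mvertex) \in X) = (inl (etgt e) \in X).
  exact: along (inl e).
have [_ conn] := graph_conn G.
have vertX (u v : vertex G) : ((inl u : mvertex) \in X) -> (inl v : mvertex) \in X.
  have /connectP[p] := conn u v.
  elim: p u => [u _ -> //|w p IH u] /= /andP[/existsP[e ends] wp vE] uX.
  apply: IH wp vE _.
  by case/orP: ends uX => /andP[/eqP<- /eqP<-]; rewrite edgeX.
have [u0 u0X] : exists u0 : vertex G, (inl u0 : mvertex) \in X.
  case: v0 v0X => [u|p] pX; first by exists u.
  by exists (etgt (bedge p)); rewrite -(along (inr p)).
apply/setP => v; rewrite !inE; case: v => [u|p]; first exact: vertX u0X.
by rewrite (along (inr p)); exact: vertX u0X.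
Qed.

End Model.

(** * Convex functions with integer slopes *)

Section Convexity.
Local Open Scope classical_set_scope.
Context {R : realType}.
Implicit Types (H : R -> R) (a b c m : R).

Definition affine_right H a m :=
  exists2 d : R, a < d & forall y, a <= y -> y < d -> H y = H a + m * (y - a).
Definition affine_left H a m :=
  exists2 d : R, d < a & forall y, d < y -> y <= a -> H y = H a + m * (y - a).

Lemma affine_right_closed H a b m : a < b -> H x @[x --> a^'+] --> H a ->
  (forall x y, a < x < b -> a < y < b -> H y = H x + m * (y - x)) ->
  affine_right H a m.
Proof.
move=> ab cH affH; exists b => // y; rewrite le_eqVlt => /predU1P[->|ay] yb.
  by rewrite subrr mulr0 addr0.
have yab : a < y < b by rewrite ay.
have H1 : H x @[x --> a^'+] --> H y + m * (a - y).
  have lim : (H y + m * (x - y)) @[x --> a^'+] --> H y + m * (a - y).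
    apply: cvgD; first exact: cvg_cst.
    apply: cvgM; first exact: cvg_cst.
    apply: cvgB; last exact: cvg_cst.
    exact/cvg_at_right_filter/cvg_id.
  apply: cvg_trans lim; apply: near_eq_cvg; near=> x.
  by apply/esym/affH => //; apply/andP; split; near: x; [exact: nbhs_right_gt|exact: nbhs_right_lt].
have -> : H a = H y + m * (a - y) := cvg_unique _ cH H1.
by ring.
Unshelve. all: by end_near. Qed.

Lemma affine_left_closed H a b m : b < a -> H x @[x --> a^'-] --> H a ->
  (forall x y, b < x < a -> b < y < a -> H y = H x + m * (y - x)) ->
  affine_left H a m.
Proof.
move=> ba cH affH; exists b => // y by_; rewrite le_eqVlt => /predU1P[->|ya].
  by rewrite subrr mulr0 addr0.
have yab : b < y < a by rewrite by_.
have H1 : H x @[x --> a^'-] --> H y + m * (a - y).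
  have lim : (H y + m * (x - y)) @[x --> a^'-] --> H y + m * (a - y).
    apply: cvgD; first exact: cvg_cst.
    apply: cvgM; first exact: cvg_cst.
    apply: cvgB; last exact: cvg_cst.
    exact/cvg_at_left_filter/cvg_id.
  apply: cvg_trans lim; apply: near_eq_cvg; near=> x.
  by apply/esym/affH => //; apply/andP; split; near: x; [exact: nbhs_left_gt|exact: nbhs_left_lt].
have -> : H a = H y + m * (a - y) := cvg_unique _ cH H1.
by ring.
Unshelve. all: by end_near. Qed.

Section MaxPrinciple.
Variables (H : R -> R) (a b : R).
Hypothesis ab : a < b.
Hypothesis cH : {within `[a, b], continuous H}.
Hypothesis convex : forall c, a < c < b -> exists l r : int,
  [/\ l <= r, affine_left H c l%:~R & affine_right H c r%:~R].

(** At an interior maximum of H - sigma t the slope of H on the left is at least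
    sigma and the slope on the right is at most sigma.  Convexity forces both to
    be equal to sigma, which is excluded since sigma is not an integer. *)
Lemma tilted_max (sigma : R) : sigma \isn't a Num.int -> forall t, a <= t <= b ->
  H t - sigma * t <= Num.max (H a - sigma * a) (H b - sigma * b).
Proof.
move=> sNint; pose k t := H t - sigma * t.
have ck : {within `[a, b], continuous k}.
  move=> x; apply: continuousB; first exact: cH.
  apply: continuousM; first exact: cvg_cst.
  by apply: continuous_subspaceT => y; exact: cvg_id.
have [c cab kc] := EVT_max (ltW ab) ck.
move=> t tab; rewrite -!/(k _); have : k t <= k c by apply: kc; rewrite in_itv.
move/le_trans; apply; rewrite le_max.
move: cab; rewrite in_itv /= => /andP[]; rewrite !le_eqVlt.
move=> /predU1P[->|ac]; first by rewrite eqxx.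
move=> /predU1P[->|cb]; first by rewrite eqxx orbT.
have [|l [r [lr [dl dlc Hl] [dr cdr Hr]]]] := convex (c := c); first by rewrite ac.
exfalso; move/negP: sNint; apply.
suff -> : sigma = l%:~R by rewrite intr_int.
have lr' : l%:~R <= r%:~R :> R by rewrite ler_int.
have ge_l : sigma <= l%:~R.
  pose y := (Num.max a dl + c) / 2.
  have [ya yd yc] : [/\ a <= y, dl < y & y < c].
    by rewrite /y; case: (leP a dl) => ?; split; lra.
  have : k y <= k c by apply: kc; rewrite in_itv /= ya (ltW (lt_trans yc cb)).
  rewrite /k (Hl y yd (ltW yc)) => kyc.
  rewrite -subr_ge0 -(pmulr_lge0 _ (_ : 0 < c - y)) ?subr_gt0 //.
  by lra.
have le_r : r%:~R <= sigma.
  pose y := (Num.min b dr + c) / 2.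
  have [ya yd yc] : [/\ y <= b, y < dr & c < y].
    by rewrite /y; case: (leP b dr) => ?; split; lra.
  have : k y <= k c by apply: kc; rewrite in_itv /= ya (ltW (lt_trans ac yc)).
  rewrite /k (Hr y (ltW yc) yd) => kyc.
  rewrite -subr_ge0 -(pmulr_lge0 _ (_ : 0 < y - c)) ?subr_gt0 //.
  by lra.
by apply/eqP; rewrite eq_le ge_l (le_trans lr').
Qed.

Lemma nonint_between (x : R) (m : int) : x < m%:~R ->
  exists2 sigma : R, sigma \isn't a Num.int & x < sigma < m%:~R.
Proof.
move=> xm; pose sigma := (Num.max x (m - 1)%:~R + m%:~R) / 2.
have [s1 s2 s3] : [/\ x < sigma, (m - 1)%:~R < sigma & sigma < m%:~R].
  by rewrite /sigma intrB mulr1z; case: (leP x (m%:~R - 1)) => ?; split; lra.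
exists sigma; last by rewrite s1.
apply/intrP => -[n sE]; move: s2 s3; rewrite sE !ltr_int; lia.
Qed.

(** Otherwise tilt H by a non-integer sigma between the chord and the slope: the
    tilted function rises at a above both of its end values. *)
Lemma right_slope_le_chord (m : int) : affine_right H a m%:~R ->
  m%:~R <= (H b - H a) / (b - a).
Proof.
move=> [d ad Hd].
pose y := (Num.min b d + a) / 2.
have [ya yd yc] : [/\ y <= b, y < d & a < y].
  by rewrite /y; have := ab; case: (leP b d) => ?; split; lra.
rewrite leNgt; apply/negP => /nonint_between[sigma sNint /andP[sl su]].
have chordE : H b - H a = (H b - H a) / (b - a) * (b - a).
  by rewrite divfK // subr_eq0 gt_eqF.
have kba : H b - sigma * b <= H a - sigma * a.
  have : (H b - H a) / (b - a) * (b - a) <= sigma * (b - a).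
    by rewrite ler_pM2r ?subr_gt0 // ltW.
  by rewrite -chordE; lra.
have := tilted_max sNint (t := y); rewrite (ltW yc) ya => /(_ isT).
rewrite (max_idPl kba) (Hd y (ltW yc) yd).
have : 0 < (m%:~R - sigma) * (y - a) by rewrite mulr_gt0 ?subr_gt0.
by lra.
Qed.

Lemma left_slope_ge_chord (m : int) : affine_left H b m%:~R ->
  (H b - H a) / (b - a) <= m%:~R.
Proof.
move=> [d db Hd].
pose y := (Num.max a d + b) / 2.
have [ya yd yc] : [/\ a <= y, d < y & y < b].
  by rewrite /y; have := ab; case: (leP a d) => ?; split; lra.
rewrite leNgt; apply/negP => chord_gt.
have [|sigma' sNint' /andP[sl' su']] :=
  @nonint_between (- ((H b - H a) / (b - a))) (- m); first by rewrite intrN ltrN2.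
pose sigma := - sigma'; have sNint : sigma \isn't a Num.int by rewrite /sigma rpredN.
have [sl su] : m%:~R < sigma /\ sigma < (H b - H a) / (b - a).
  by rewrite /sigma; rewrite intrN in su'; split; lra.
have chordE : H b - H a = (H b - H a) / (b - a) * (b - a).
  by rewrite divfK // subr_eq0 gt_eqF.
have kab : H a - sigma * a <= H b - sigma * b.
  have : sigma * (b - a) <= (H b - H a) / (b - a) * (b - a).
    by rewrite ler_pM2r ?subr_gt0 // ltW.
  by rewrite -chordE; lra.
have := tilted_max sNint (t := y); rewrite (ltW yc) ya => /(_ isT).
rewrite (max_idPr kab) (Hd y yd (ltW yc)).
have : 0 < (sigma - m%:~R) * (b - y) by rewrite mulr_gt0 ?subr_gt0.
by lra.
Qed.

End MaxPrinciple.
End Convexity.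

(** * Rational functions along an edge *)

Section EdgeFunctions.
Local Open Scope classical_set_scope.
Context {R : realType} {G : tropical_curve R}.
Implicit Types (f : tpoint G -> \bar R) (e : edge G).

(** The topology is the final one for the parametrizations of the edges. *)
Lemma continuous_on_edges f : continuous f <->
  forall e, continuous (f \o edge_point e : subspace (edge_dom e) -> \bar R).
Proof.
split=> [/continuousP cf e|cf].
  by apply/continuousP => A /cf oA; exact: (oA e).
apply/continuousP => A oA; change (tpoint_open (f @^-1` A)) => e.
by have /continuousP := cf e; exact.
Qed.

Lemma edge_point_finite e (t : R) : 0 <= t -> (t%:E <= len e)%E ->
  ~ at_infinity (edge_point e t%:E).
Proof.
move=> t0 te [e' [e'oo]]; rewrite /edge_point.
case: insubP => [//|]; rewrite /is_inner /= negb_and -!leNgt.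
case: ifPn => [_ _ []|tN0] ; first by move/eqP; rewrite (negPf (esrc_not_infty e e'oo)).
rewrite /= => et [] /etgt_infty eE; move: et.
by rewrite (eE e'oo) e'oo leye_eq.
Qed.

Variable (f : tpoint G -> \bar R).
Hypothesis rat_f : rational_function f.

(** The restriction of f to an edge as a real function; [fine] loses nothing away
    from the points at infinity. *)
Definition edge_fun e (t : R) : R := fine (f (edge_point e t%:E)).

Lemma edge_funE e (t : R) : 0 <= t -> (t%:E <= len e)%E ->
  f (edge_point e t%:E) = (edge_fun e t)%:E.
Proof.
move=> t0 te; rewrite /edge_fun fineK //; case: rat_f => _ fin _; apply: fin.
exact: edge_point_finite.
Qed.

Lemma edge_fun_continuous e (a b : R) : 0 <= a -> (b%:E <= len e)%E ->
  {within `[a, b], continuous (edge_fun e)}.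
Proof.
move=> a0 be; apply/subspace_continuousP => x /=; rewrite in_itv /= => /andP[ax xb].
have x0 : 0 <= x by lra.
have xe : (x%:E <= len e)%E by rewrite (le_trans _ be) // lee_fin.
apply: fine_cvg; rewrite -edge_funE //.
have [/continuous_on_edges/(_ e)/subspace_continuousP cf _ _] := rat_f.
have xdom : edge_dom e x%:E by rewrite /edge_dom /= lee_fin x0.
move=> U HU.
have nU : nbhs x%:E (fun t => edge_dom e t -> U (f (edge_point e t))) := cf _ xdom U HU.
move/nbhs_EFin: nU.
apply: filterS => y /= H; rewrite in_itv /= => /andP[ay yb]; apply: H.
by rewrite /edge_dom /= lee_fin (le_trans a0 ay) (le_trans _ be) ?lee_fin.
Qed.

Lemma affine_on_edge_fun e (a b : \bar R) m (x y : R) : (0 <= a)%E -> (b <= len e)%E ->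
  affine_on (f \o edge_point e) a b m ->
  (a < x%:E < b)%E -> (a < y%:E < b)%E -> edge_fun e y = edge_fun e x + m%:~R * (y - x).
Proof.
move=> a0 be hm xab yab; have [_] := hm _ _ xab yab.
have inside z : (a < z%:E < b)%E -> f (edge_point e z%:E) = (edge_fun e z)%:E.
  case/andP=> az zb; apply: edge_funE; first by rewrite -lee_fin ltW ?(le_lt_trans a0).
  by rewrite ltW // (lt_le_trans zb).
by rewrite /= !inside // -EFinD => -[].
Qed.

Lemma edge_fun_right e (t : R) : 0 <= t -> (t%:E < len e)%E ->
  affine_right (edge_fun e) t (fwd_slope f e t%:E)%:~R.
Proof.
move=> t0 te; have [_ _ /(_ e) pl] := rat_f.
have [|b /andP[tb be] hm] := fwd_slopeP (t := t%:E) pl; first by rewrite lee_fin t0.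
have [c /andP[tc cb]] := ereal_between tb; rewrite lte_fin in tc.
have ce : (c%:E <= len e)%E by rewrite ltW // (lt_le_trans cb).
apply: (affine_right_closed tc).
  by have /(continuous_within_itvP _ tc)[] := edge_fun_continuous t0 ce.
move=> x y /andP[tx xc] /andP[ty yc]; apply: (affine_on_edge_fun _ be hm);
  by rewrite ?lee_fin // lte_fin ?tx ?ty /= (lt_trans _ cb) ?lte_fin.
Qed.

Lemma edge_fun_left e (t : R) : 0 < t -> (t%:E <= len e)%E ->
  affine_left (edge_fun e) t (- bwd_slope f e t%:E)%:~R.
Proof.
move=> t0 te; have [_ _ /(_ e) pl] := rat_f.
have [|b /andP[b0 bt] hm] := bwd_slopeP (t := t%:E) pl; first by rewrite lte_fin t0.
have [c /andP[bc ct]] := ereal_between bt; rewrite lte_fin in ct.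
have c0 : 0 <= c by rewrite -lee_fin ltW // (le_lt_trans b0).
apply: (affine_left_closed ct).
  by have /(continuous_within_itvP _ ct)[] := edge_fun_continuous c0 te.
move=> x y /andP[cx xt] /andP[cy yt]; apply: (affine_on_edge_fun b0 te hm);
  by rewrite ?lte_fin ?xt ?yt andbT (lt_trans bc) ?lte_fin.
Qed.

End EdgeFunctions.

(** * The rational function of a potential *)

Section FunctionOfPotential.
Local Open Scope classical_set_scope.
Context {R : realType} {G : tropical_curve R}.
Variable s : seq {p : edge G * R | is_inner p}.
Notation src := (@ssrc R G s).
Notation tgt := (@stgt R G s).
Notation slen := (@slen R G s).

Variable phi : mvertex s -> R.

Definition kslope (x : segment s) : int := Num.floor (chord src tgt slen phi x).

(** On a segment of finite length the interpolation has slope [kslope x] up to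
    this distance from the start and slope [kslope x + 1] beyond it, which makes
    it reach the prescribed value at the end.  If the chord is integral, then the
    distance is the full length of the segment. *)
Definition kink (x : segment s) : R :=
  ((kslope x)%:~R + 1 - chord src tgt slen phi x) * slen x.

(** On a segment of infinite length the interpolation keeps its first slope
    [kslope x]: the slope outgoing from the point at infinity is then at least
    the floor required there. *)
Definition interp (x : segment s) (t : R) : R :=
  phi (ssrc x) +
  (if send x == +oo%E then (kslope x)%:~R * (t - sstart x)
   else Num.max ((kslope x)%:~R * (t - sstart x))
                (((kslope x)%:~R + 1) * (t - sstart x) - kink x)).

(** The limit of the interpolation; the product is 0 if the slope is 0. *)
Definition interp_infty (x : segment s) : \bar R :=
  ((phi (ssrc x) - (kslope x)%:~R * sstart x)%:E + (kslope x)%:~R%:E * +oo)%E.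

(** An inner point lies on exactly one half-open segment, so that the default
    value 0 is never reached. *)
Definition fun_of_potential (P : tpoint G) : \bar R :=
  match P with
  | inl v => if [pick x : segment s | (stgt x == inl v) && (send x == +oo%E)]
             is Some x then interp_infty x else (phi (inl v))%:E
  | inr p => if [pick x : segment s | [&& sedge x == (val p).1,
                  sstart x <= (val p).2 & ((val p).2%:E < send x)%E]]
             is Some x then (interp x (val p).2)%:E else 0%E
  end.
Notation g := fun_of_potential.

Lemma kink_gt0 x : 0 < kink x.
Proof.
rewrite mulr_gt0 ?slen_gt0 // subr_gt0.
by have := floorD1_gt (chord src tgt slen phi x); rewrite intrD mulr1z.
Qed.

Lemma kink_le x : kink x <= slen x.
Proof.
rewrite -[leRHS]mul1r ler_pM2r ?slen_gt0 //.
by have := floor_le (chord src tgt slen phi x); rewrite /kslope; lra.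
Qed.

Lemma interp_start x : interp x (sstart x) = phi (ssrc x).
Proof.
rewrite /interp subrr !mulr0 sub0r; case: ifP => _; first by rewrite addr0.
by rewrite (max_idPl _) ?addr0 // oppr_le0 ltW ?kink_gt0.
Qed.

Lemma interp_end x r : send x = r%:E -> interp x r = phi (stgt x).
Proof.
move=> xr; rewrite /interp xr /=.
have L_gt0 := slen_gt0 x; have slenE : slen x = r - sstart x by rewrite /slen xr.
have endE : chord src tgt slen phi x * slen x = phi (stgt x) - phi (ssrc x).
  by rewrite divfK // gt_eqF.
have -> : ((kslope x)%:~R + 1) * (r - sstart x) - kink x =
          phi (stgt x) - phi (ssrc x).
  by rewrite -endE /kink -slenE; ring.
rewrite (max_idPr _); first by ring.
rewrite -endE -slenE ler_pM2r //.
exact: floor_le.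
Qed.

Lemma fun_of_potential_mpoint v :
  (forall x : segment s, send x = +oo%E -> stgt x != v) -> g (mpoint v) = (phi v)%:E.
Proof.
case: v => [u|q] notoo /=.
  by case: pickP => // x /andP[/eqP xu /eqP /notoo]; rewrite xu eqxx.
case: pickP => [x /and3P[/eqP xe xq qx]|/(_ (inr q))]; last first.
  rewrite /= eqxx lexx /= => /negP[].
  exact: (sstart_lt_send (inr q : segment s)).
suff -> : x = inr q by rewrite (interp_start (inr q)).
apply: (@segment_uniq _ _ s x (inr q) (bpos q)%:E) => //.
  by rewrite lee_fin xq.
by rewrite lexx; exact: (sstart_lt_send (inr q : segment s)).
Qed.

Lemma fun_of_potential_segment x t : sstart x <= t -> (t%:E <= send x)%E ->
  g (edge_point (sedge x) t%:E) = (interp x t)%:E.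
Proof.
move=> xt tx; have [xt'|tx'|<-] := ltgtP (sstart x) t; last 2 first.
- by have := le_lt_trans xt tx'; rewrite ltxx.
- rewrite edge_point_sstart interp_start fun_of_potential_mpoint // => y yoo.
  exact: ssrc_not_infty.
move: tx; rewrite le_eqVlt => /predU1P[tx|tx].
  rewrite tx edge_point_send (interp_end (esym tx)) fun_of_potential_mpoint // => y yoo.
  apply/eqP => /esym /(send_infty_uniq yoo) xy.
  by move: tx; rewrite xy yoo.
have t_in : is_inner (sedge x, t).
  by rewrite /is_inner /= (le_lt_trans (sstart_ge0 x)) // (lt_le_trans tx) // send_le_len.
rewrite /edge_point insubT /=.
case: pickP => [y /and3P[/eqP ye yt ty]|/(_ x)]; last by rewrite eqxx xt tx.
suff -> : y = x by [].
by apply: (@segment_uniq _ _ s y x t%:E); rewrite // lee_fin ?yt ?xt.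
Qed.

Lemma fun_of_potential_infty x : send x = +oo%E ->
  g (edge_point (sedge x) +oo%E) = interp_infty x.
Proof.
move=> xoo; have [_ xE] := send_infty xoo.
rewrite /=; case: pickP => [y /andP[/eqP yx /eqP yoo]|/(_ x)].
  by rewrite (send_infty_uniq (x := y) xoo) // yx xE.
by rewrite xE xoo !eqxx.
Qed.

Definition late x (t : R) : bool := (send x != +oo%E) && (sstart x + kink x <= t).
Definition early_eq x (t : R) : bool := (send x == +oo%E) || (t <= sstart x + kink x).

Lemma interp_early x t : early_eq x t ->
  interp x t = phi (ssrc x) + (kslope x)%:~R * (t - sstart x).
Proof.
rewrite /early_eq /interp; case: eqP => //= _ tk.
by rewrite (max_idPl _) //; lra.
Qed.

Lemma interp_late x t : late x t ->
  interp x t = phi (ssrc x) + ((kslope x)%:~R + 1) * (t - sstart x) - kink x.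
Proof.
rewrite /late /interp; case: eqP => //= _ tk.
by rewrite (max_idPr _) ?addrA //; lra.
Qed.

Lemma affine_segment x (a b : \bar R) (m : int) :
  ((sstart x)%:E <= a)%E -> (b <= send x)%E ->
  (forall u v : R, (a < u%:E < b)%E -> (a < v%:E < b)%E ->
     interp x v = interp x u + m%:~R * (v - u)) ->
  affine_on (g \o edge_point (sedge x)) a b m.
Proof.
move=> xa bx H u v uab vab.
have inside z : (a < z%:E < b)%E -> g (edge_point (sedge x) z%:E) = (interp x z)%:E.
  case/andP=> az zb; apply: fun_of_potential_segment.
    by rewrite -lee_fin (le_trans xa) // ltW.
  by rewrite (le_trans _ bx) // ltW.
by rewrite /= !inside // (H _ _ uab vab).
Qed.

Lemma fwd_affine x t : sstart x <= t -> (t%:E < send x)%E -> exists b,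
  [/\ (b == (sstart x + kink x)%:E) || (b == send x), (t%:E < b <= send x)%E &
    affine_on (g \o edge_point (sedge x)) t%:E b (kslope x + late x t)].
Proof.
move=> xt tx; case: (boolP (late x t)) => [lt|].
  exists (send x); split; rewrite ?eqxx ?orbT ?tx ?lexx //.
  apply: affine_segment; rewrite ?lee_fin ?lexx // => u v /andP[tu _] /andP[tv _].
  have late_ge w : (t%:E < w%:E)%E -> late x w.
    by case/andP: lt => xoo le_t; rewrite lte_fin /late xoo => /ltW /(le_trans le_t).
  by rewrite !interp_late ?late_ge // intrD mulr1z; ring.
rewrite /late negb_and negbK; have [xoo _|/eqP xN /=] := eqP.
  exists (send x); split; rewrite ?eqxx ?orbT ?tx ?lexx //.
  apply: affine_segment; rewrite ?lee_fin ?lexx // => u v _ _.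
  by rewrite !interp_early ?/early_eq ?xoo ?eqxx // addr0; ring.
rewrite -ltNge => tk; exists (sstart x + kink x)%:E.
have kx : ((sstart x + kink x)%:E <= send x)%E.
  have := kink_le x; rewrite /slen; case: (send x) xN (sstart_lt_send x) => //= r _ _.
  by rewrite lee_fin; lra.
rewrite eqxx lte_fin tk kx; split => //.
apply: affine_segment; rewrite ?lee_fin // => u v /andP[_ uk] /andP[_ vk].
rewrite !interp_early; first by rewrite addr0; ring.
- by rewrite /early_eq ltW ?orbT // -lte_fin.
- by rewrite /early_eq ltW ?orbT // -lte_fin.
Qed.

Lemma bwd_affine x (t : \bar R) (b : bool) : ((sstart x)%:E < t <= send x)%E ->
  b = (send x != +oo%E) && ((sstart x + kink x)%:E < t)%E ->
  exists2 a, (0 <= a < t)%E &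
    affine_on (g \o edge_point (sedge x)) a t (kslope x + b).
Proof.
move=> /andP[xt tx] ->; case: (boolP (_ && _)) => [/andP[xN kt]|].
  exists (sstart x + kink x)%:E.
    by rewrite kt lee_fin addr_ge0 ?sstart_ge0 // ltW ?kink_gt0.
  apply: affine_segment => //.
    by rewrite lee_fin lerDl ltW ?kink_gt0.
  move=> u v /andP[ku _] /andP[kv _].
  rewrite !interp_late; first by rewrite intrD mulr1z; ring.
  - by rewrite /late xN -lee_fin ltW.
  - by rewrite /late xN -lee_fin ltW.
rewrite negb_and negbK -leNgt => H; exists (sstart x)%:E.
  by rewrite xt lee_fin sstart_ge0.
apply: affine_segment => // u v /andP[_ ut] /andP[_ vt].
rewrite !interp_early; first by rewrite addr0; ring.
- by case/orP: H => [xoo|tk]; rewrite /early_eq ?xoo // -lee_fin (le_trans (ltW ut)) ?orbT.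
- by case/orP: H => [xoo|tk]; rewrite /early_eq ?xoo // -lee_fin (le_trans (ltW vt)) ?orbT.
Qed.

Lemma fun_of_potential_continuous_segment (x : segment s) :
  {within [set t | (sstart x)%:E <= t <= send x]%E,
    continuous (g \o edge_point (sedge x))}.
Proof.
set I := [set _ | _].
have real_of t : I t -> t != +oo%E -> t = (fine t)%:E.
  by case: t => [r| |] // /andP[+ _]; rewrite leeNy_eq.
have [xoo|/eqP xN] := eqVneq (send x) +oo%E.
  pose h (t : \bar R) := ((phi (ssrc x) - (kslope x)%:~R * sstart x)%:E +
                          (kslope x)%:~R%:E * t)%E.
  apply: (@subspace_eq_continuous _ _ _ (h : subspace I -> \bar R)).
    move=> t; rewrite inE => It; have [->|tN] := eqVneq t +oo%E.
      exact/esym/fun_of_potential_infty.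
    rewrite (real_of _ It tN) /from_subspace /=.
    have := It; rewrite (real_of _ It tN) => /andP[xt tx].
    rewrite fun_of_potential_segment // interp_early /early_eq ?xoo //.
    by rewrite /h -EFinM -EFinD; congr EFin; ring.
  apply: continuous_subspaceT => t; apply: cvgeD.
  - exact: fin_num_adde_defr.
  - exact: cvg_cst.
  - by apply: cvgeZl => //; exact: cvg_id.
pose h (t : \bar R) := (interp x (fine t))%:E.
have fin_I t : I t -> t = (fine t)%:E.
  move=> It; apply: (real_of _ It); apply/eqP => toe; move: It; rewrite toe.
  by case/andP => _; rewrite leye_eq => /eqP.
apply: (@subspace_eq_continuous _ _ _ (h : subspace I -> \bar R)).
  move=> t; rewrite inE => It; have := It; rewrite (fin_I _ It) => /andP[xt tx].
  by rewrite /from_subspace /= fun_of_potential_segment.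
apply/subspace_continuousP => t It; rewrite (fin_I _ It).
have ci : {for fine t, continuous (interp x)}.
  rewrite /interp (negPf (introN eqP xN)); apply: cvgD; first exact: cvg_cst.
  apply: (@continuous_max _ _ (fun r => (kslope x)%:~R * (r - sstart x))
           (fun r => ((kslope x)%:~R + 1) * (r - sstart x) - kink x) (fine t)).
    apply: cvgM; first exact: cvg_cst.
    by apply: cvgB; [exact: cvg_id|exact: cvg_cst].
  apply: cvgB; last exact: cvg_cst.
  apply: cvgM; first exact: cvg_cst.
  by apply: cvgB; [exact: cvg_id|exact: cvg_cst].
have hc : h z @[z --> (fine t)%:E] --> h (fine t)%:E.
  apply: cvg_EFin; first by near=> z.
  apply: (@cvg_comp _ _ _ fine (interp x) _ (nbhs (fine t))); last exact: ci.
  by apply: (@fine_cvg _ _ _ _ id); exact: cvg_id.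
by apply: (cvg_trans _ hc); apply: cvg_fmap2; exact: cvg_within.
Unshelve. all: by end_near. Qed.

(** The segments of an edge are finitely many closed intervals that cover it, and
    the function is continuous on each of them. *)
Lemma continuous_fun_of_potential : continuous g.
Proof.
apply/continuous_on_edges => e.
pose I (x : segment s) := [set t | (sstart x)%:E <= t <= send x]%E.
have closedI x : closed (I x).
  have -> : I x = [set t | (sstart x)%:E <= t]%E `&` [set t | t <= send x]%E.
    by apply/seteqP; split => t /=; [move/andP|move=> [xt tx]; apply/andP].
  by apply: topology_structure.closedI; [exact: closed_ereal_le_ereal|exact: closed_ereal_ge_ereal].
have within_list (xs : seq (segment s)) : (forall x, x \in xs -> sedge x = e) ->
    {within \big[setU/set0]_(x <- xs) I x, continuous (g \o edge_point e)}.
  elim: xs => [|x xs IH] xe; first by rewrite big_nil; exact: continuous_subspace0.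
  rewrite big_cons; apply: withinU_continuous => //.
  - by apply: closed_bigsetU => ? _.
  - by rewrite -(xe x) ?mem_head //; exact: fun_of_potential_continuous_segment.
  - by apply: IH => y yxs; apply: xe; rewrite in_cons yxs orbT.
pose xs := [seq x <- enum (segment s) | sedge x == e].
apply: (@continuous_subspaceW _ _ _ (\big[setU/set0]_(x <- xs) I x)); last first.
  by apply: within_list => x; rewrite mem_filter => /andP[/eqP].
have memI x t : sedge x = e -> I x t -> (\big[setU/set0]_(y <- xs) I y) t.
  move=> xe It; rewrite -bigcup_seq; exists x => //=.
  by rewrite mem_filter xe eqxx mem_enum.
move=> t /andP[]; rewrite le_eqVlt => /predU1P[<- _|t0 te].
  apply: (memI (inl e)) => //; rewrite /I /= lexx /=.
  exact/ltW/(sstart_lt_send (inl e : segment s)).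
case: t t0 te => [r| |] // t0 te.
  have [x [xe /andP[xt tx]]] := segment_cover_right s t0 te.
  by apply: (memI x) => //; rewrite /I /= ltW.
have eoo : len e = +oo%E by apply/eqP; rewrite -leye_eq.
have [x xE] : exists x : segment s, snext x = inl e.
  have [f _ fK] := injF_bij (@snext_inj _ _ s); by exists (f (inl e)).
have xe : sedge x = e by rewrite -sedge_next xE.
by apply: (memI x) => //; rewrite /I /= /send xE /= eoo leey lexx.
Qed.

Lemma piecewise_fun_of_potential e :
  piecewise_linear (len e) (g \o edge_point e).
Proof.
pose bs := [seq (sstart x + kink x)%:E | x : segment s] ++ [seq send x | x : segment s].
apply: (piecewise_linear_ends (bs := bs)); first exact: len_gt0.
case=> [t| |] // /andP[t0 te].
  have [x [xe /andP[xt tx]]] := segment_cover s t0 te; subst e.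
  have [b [bE /andP[tb bx] hb]] := fwd_affine xt tx.
  exists b, (kslope x + late x t); split => //.
    rewrite mem_cat; case/orP: bE => /eqP ->; rewrite map_f ?mem_enum ?orbT //.
  by rewrite tb (le_trans bx) ?send_le_len.
by move: te; rewrite ltNge leey.
Qed.

Lemma fwd_slope_fun x t : sstart x <= t -> (t%:E < send x)%E ->
  fwd_slope g (sedge x) t%:E = kslope x + late x t.
Proof.
move=> xt tx; have [b [_ /andP[tb bx] hb]] := fwd_affine xt tx.
by apply: fwd_slopeE hb; rewrite tb (le_trans bx) ?send_le_len.
Qed.

Lemma bwd_slope_fun x (t : \bar R) : ((sstart x)%:E < t <= send x)%E ->
  bwd_slope g (sedge x) t =
  - (kslope x + ((send x != +oo%E) && ((sstart x + kink x)%:E < t)%E)).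
Proof.
move=> xt; have [a a0 ha] := bwd_affine xt erefl.
exact: bwd_slopeE ha.
Qed.

(** Equality holds except possibly at the points at infinity. *)
Lemma fdiv_le_ord_at v : fdiv src tgt slen phi v <= ord_at g (mpoint v).
Proof.
rewrite ord_at_mpoint; apply: le_star_sum => x _.
  by rewrite fwd_slope_fun ?sstart_lt_send //= -/(kslope x) lerDl.
rewrite bwd_slope_fun ?sstart_lt_send ?lexx //.
have := floorDN_le0 (chord src tgt slen phi x); rewrite -/(kslope x).
case: (boolP (_ && _)) => [/andP[xN kx]|_] /=; last by lia.
have chordNint : chord src tgt slen phi x \isn't a Num.int.
  rewrite intrEfloor; apply: contraTN kx => /eqP kE.
  move: xN (slen_gt0 x); rewrite /kink -kE /slen -/(kslope x).
  case: (send x) (sstart_lt_send x) => //= r _ _ _; by rewrite lte_fin -leNgt; lra.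
by have := floorDN (chord src tgt slen phi x); rewrite (negPf chordNint) -/(kslope x) /=; lia.
Qed.

(** The interpolation is convex on every segment. *)
Lemma ord_at_inner_ge0 P : (forall v : mvertex s, mpoint v <> P) -> 0 <= ord_at g P.
Proof.
case: P => [v|p] notP; first by have := notP (inl v).
rewrite /ord_at; case pE: (val p) => [e t].
have /andP[] := valP p; rewrite pE /= => t0 te.
have [x [xe /andP[xt tx]]] := segment_cover s (ltW t0) te; subst e.
have xt' : ((sstart x)%:E < t%:E)%E.
  rewrite lt_neqAle xt andbT; apply/negP => /eqP -[xtE].
  apply: (notP (ssrc x)); rewrite -edge_point_sstart xtE -[RHS]edge_point_inner.
  by rewrite pE.
rewrite fwd_slope_fun // bwd_slope_fun; last by rewrite xt' ltW.
rewrite /late lte_fin; case: eqP => //= _; first by lia.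
by case: ltgtP => //= _; lia.
Qed.

Lemma rational_fun_of_potential : rational_function g.
Proof.
split; [exact: continuous_fun_of_potential| |exact: piecewise_fun_of_potential].
case=> [v|p] notoo /=; last by case: pickP.
case: pickP => // x /andP[/eqP xv /eqP /send_infty[leny xE]].
exfalso; apply: notoo; exists (sedge x); split => //.
by have [->] : inl v = inl (etgt (sedge x)) :> mvertex s by rewrite -xv.
Qed.

End FunctionOfPotential.

(** * The potential of a rational function *)

Section PotentialOfFunction.
Context {R : realType} {G : tropical_curve R}.
Variable s : seq {p : edge G * R | is_inner p}.
Notation src := (@ssrc R G s).
Notation tgt := (@stgt R G s).
Notation slen := (@slen R G s).

Variable (f : tpoint G -> \bar R).
Hypothesis rat_f : rational_function f.

(** At a point at infinity the value of f is replaced by the one for which the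
    chord of the last segment, taken to have length 1, is the slope of f at the
    start of this segment. *)
Definition potential (v : mvertex s) : R :=
  if [pick x : segment s | (stgt x == v) && (send x == +oo%E)] is Some x
  then fine (f (mpoint (ssrc x))) + (fwd_slope f (sedge x) (sstart x)%:E)%:~R
  else fine (f (mpoint v)).

Lemma potential_src (x : segment s) :
  potential (ssrc x) = edge_fun f (sedge x) (sstart x).
Proof.
rewrite /potential; case: pickP => [y /andP[/eqP yx /eqP yoo]|_].
  by have := ssrc_not_infty x yoo; rewrite yx eqxx.
by rewrite /edge_fun edge_point_sstart.
Qed.

Lemma potential_tgt (x : segment s) r : send x = r%:E ->
  potential (stgt x) = edge_fun f (sedge x) r.
Proof.
move=> xr; rewrite /potential; case: pickP => [y /andP[/eqP yx /eqP yoo]|_].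
  by move: xr; rewrite (send_infty_uniq yoo (esym yx)) yoo.
by rewrite /edge_fun -xr edge_point_send.
Qed.

Lemma potential_infty (x : segment s) : send x = +oo%E ->
  potential (stgt x) = potential (ssrc x) + (fwd_slope f (sedge x) (sstart x)%:E)%:~R.
Proof.
move=> xoo; rewrite potential_src {1}/potential.
case: pickP => [y /andP[/eqP yx /eqP yoo]|/(_ x)]; last by rewrite xoo !eqxx.
by rewrite (send_infty_uniq xoo yx) /edge_fun edge_point_sstart.
Qed.

Hypothesis ord_ge0 : forall P, (forall v : mvertex s, mpoint v <> P) -> 0 <= ord_at f P.

Lemma slopes_convex (x : segment s) c : sstart x < c -> (c%:E < send x)%E ->
  - bwd_slope f (sedge x) c%:E <= fwd_slope f (sedge x) c%:E.
Proof.
move=> xc cx.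
have c_in : is_inner (sedge x, c).
  by rewrite /is_inner /= (le_lt_trans (sstart_ge0 x)) // (lt_le_trans cx) // send_le_len.
have := @ord_ge0 (inr (exist (fun p => is_true (is_inner p)) _ c_in)); rewrite /= => H.
rewrite -subr_ge0 opprK.
apply: H => -[//|q] [qE].
have := @send_le_bpos _ _ s x q; rewrite /bedge /bpos qE /= => /(_ erefl xc).
by rewrite leNgt cx.
Qed.

Lemma segment_convex (x : segment s) b : sstart x < b -> (b%:E <= send x)%E ->
  forall c, sstart x < c < b -> exists l r : int, [/\ l <= r,
    affine_left (edge_fun f (sedge x)) c l%:~R &
    affine_right (edge_fun f (sedge x)) c r%:~R].
Proof.
move=> xb bx c /andP[xc cb].
have cx : (c%:E < send x)%E by rewrite (lt_le_trans _ bx).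
have c_len : (c%:E < len (sedge x))%E by rewrite (lt_le_trans cx) // send_le_len.
have c0 : 0 < c by rewrite (le_lt_trans (sstart_ge0 x)).
exists (- bwd_slope f (sedge x) c%:E), (fwd_slope f (sedge x) c%:E); split.
- exact: slopes_convex.
- by apply: edge_fun_left => //; exact: ltW.
- by apply: edge_fun_right => //; exact: ltW.
Qed.

Lemma fwd_le_chord (x : segment s) b : sstart x < b -> (b%:E <= send x)%E ->
  (fwd_slope f (sedge x) (sstart x)%:E)%:~R <=
  (edge_fun f (sedge x) b - edge_fun f (sedge x) (sstart x)) / (b - sstart x).
Proof.
move=> xb bx; apply: (right_slope_le_chord xb _ (segment_convex xb bx)).
  by apply: edge_fun_continuous => //; rewrite ?sstart_ge0 // (le_trans bx) ?send_le_len.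
by apply: edge_fun_right; rewrite ?sstart_ge0 ?sstart_lt_len.
Qed.

Lemma chord_le_bwd (x : segment s) b : sstart x < b -> (b%:E <= send x)%E ->
  (edge_fun f (sedge x) b - edge_fun f (sedge x) (sstart x)) / (b - sstart x) <=
  (- bwd_slope f (sedge x) b%:E)%:~R.
Proof.
move=> xb bx; have be := le_trans bx (send_le_len x).
apply: (left_slope_ge_chord xb _ (segment_convex xb bx)).
  by apply: edge_fun_continuous => //; rewrite ?sstart_ge0.
by apply: edge_fun_left => //; rewrite (le_lt_trans (sstart_ge0 x)).
Qed.

Lemma fwd_le_floor x : fwd_slope f (sedge x) (sstart x)%:E <=
  Num.floor (chord src tgt slen potential x).
Proof.
rewrite floor_ge_int /chord /slen; have := sstart_lt_send x.
case xE: (send x) => [r| |] //; last first.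
  by move=> _; rewrite potential_infty // divr1 addrAC subrr add0r.
rewrite lte_fin => xr; rewrite (potential_tgt xE) potential_src.
by apply: fwd_le_chord; rewrite ?xE.
Qed.

Lemma bwd_le_floor x : bwd_slope f (sedge x) (send x) <=
  Num.floor (- chord src tgt slen potential x).
Proof.
rewrite floor_ge_int /chord /slen lerNr -intrN; have := sstart_lt_send x.
case xE: (send x) => [r| |] //; last first.
  move=> _; rewrite potential_infty // divr1 addrAC subrr add0r ler_int.
  (* cut the segment at a point b of its last, unbounded, affine piece *)
  have [len_x _] := send_infty xE.
  have [_ _ /(_ (sedge x)) pl] := rat_f.
  have [|a /andP[a0 aoo] hm] := bwd_slopeP (t := +oo%E) pl.
    by rewrite len_x lexx andbT.
  have [b /andP[]] : exists b : R, (Order.max a (sstart x)%:E < b%:E < +oo)%E.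
    by apply: ereal_between; rewrite gt_max aoo ltry.
  rewrite gt_max lte_fin => /andP[ab xb] boo.
  have bE : bwd_slope f (sedge x) b%:E = - - bwd_slope f (sedge x) +oo%E.
    apply: (bwd_slopeE (a := a)); first by rewrite a0 ab.
    by apply: affine_onW hm => //; exact: ltW.
  have bx : (b%:E <= send x)%E by rewrite xE ltW.
  have := le_trans (fwd_le_chord xb bx) (chord_le_bwd xb bx).
  by rewrite ler_int bE; lia.
rewrite lte_fin => xr; rewrite (potential_tgt xE) potential_src.
by apply: chord_le_bwd; rewrite ?xE.
Qed.

(** If f has no pole inside the segments, it is convex on each of them, so that its
    outgoing slopes are bounded by the chords, hence by their floors. *)
Lemma ord_at_le_fdiv v : ord_at f (mpoint v) <= fdiv src tgt slen potential v.
Proof.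
rewrite ord_at_mpoint; apply: le_star_sum => x _;
  [exact: fwd_le_floor|exact: bwd_le_floor].
Qed.

End PotentialOfFunction.

(** * Riemann-Roch and the rank *)

Section Divisors.
Context {R : realType} {G : tropical_curve R}.
Implicit Types (D E F H : divisor G).

Definition canonical : divisor G :=
  \sum_(v : vertex G) << (valence v)%:Z - 2 *g (inl v : tpoint G) >>.

Section Embed.
Variable s : seq {p : edge G * R | is_inner p}.

Definition model_divisor (a : mvertex s -> int) : divisor G :=
  \sum_v << a v *g mpoint v >>.

Lemma coeff_model_divisor a v : coeff (mpoint v) (model_divisor a) = a v.
Proof.
rewrite raddf_sum (bigD1 v) //= coeffU eqxx mulr1 big1 ?addr0 // => u uv.
by rewrite coeffU (inj_eq (@mpoint_inj _ _ s)) (negPf uv) mulr0.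
Qed.

Lemma coeff_model_divisor0 a P : (forall v : mvertex s, mpoint v <> P) ->
  coeff P (model_divisor a) = 0.
Proof.
move=> notP; rewrite raddf_sum big1 // => v _ /=.
by rewrite coeffU; case: eqP => [/notP//|]; rewrite mulr0.
Qed.

Lemma deg_model_divisor a : deg (model_divisor a) = \sum_v a v.
Proof. by rewrite raddf_sum; apply: eq_bigr => v _; rewrite /= degU. Qed.

Lemma coeff_canonical v : coeff (mpoint v) canonical =
  star_sum (@ssrc _ _ s) (@stgt _ _ s) (fun=> 1) (fun=> 1) v - 2.
Proof.
rewrite (star_sum_segments (fun _ _ => 1) (fun _ _ => 1)) raddf_sum; case: v => [u|p].
  rewrite (bigD1 u) //= coeffU eqxx mulr1 big1 ?addr0.
    by rewrite !sumr_const !natz /valence !cardsE PoszD.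
  move=> w wu; rewrite coeffU; case: eqP => [[wuE]|]; last by rewrite mulr0.
  by rewrite wuE eqxx in wu.
by rewrite big1 // => w _ /=; rewrite coeffU mulr0.
Qed.

Lemma coeff_canonical0 P : (forall v : mvertex s, mpoint v <> P) ->
  coeff P canonical = 0.
Proof.
move=> notP; rewrite raddf_sum big1 // => w _ /=; rewrite coeffU.
by case: eqP => [wP|_]; [case: (notP (inl w))|rewrite mulr0].
Qed.
End Embed.

Lemma deg_canonical : deg canonical = 2 * genus G - 2.
Proof.
rewrite raddf_sum; under eq_bigr do rewrite /= degU.
have sumE (p : edge G -> vertex G) :
    \sum_v (#|[set e | p e == v]%SET|)%:Z = #|edge G|%:Z.
  transitivity (\sum_(e : edge G) (1 : int)); last by rewrite sumr_const natz.
  rewrite [RHS](partition_big p xpredT) //=; apply: eq_bigr => v _.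
  by rewrite sumr_const natz cardsE.
under eq_bigr do rewrite /valence PoszD.
have sum2 : \sum_(v : vertex G) (2 : int) = 2 * #|vertex G|%:Z.
  by rewrite sumr_const -[LHS]mulr_natr; congr (_ * _); exact: natz.
by rewrite sumrB big_split /= !sumE sum2 /genus; lia.
Qed.

Lemma inner_point (e : edge G) : exists p : {p : edge G * R | is_inner p}, (val p).1 = e.
Proof.
have [t t_in] := ereal_between (len_gt0 e); rewrite lte_fin in t_in.
by exists (exist (fun p => is_true (is_inner p)) (e, t) t_in).
Qed.

(** The support of F is among the vertices of the subdivision.  A point inside
    every edge is added to remove the loops. *)
Lemma exists_model F : exists s : seq {p : edge G * R | is_inner p},
  (forall e, exists p : seq_sub s, bedge p = e) /\
  (forall P, (forall v : mvertex s, mpoint v <> P) -> coeff P F = 0).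
Proof.
have /choice[mid midE] := inner_point.
pose inner (P : tpoint G) := if P is inr p then Some p else None.
exists ([seq mid e | e <- enum (edge G)] ++ pmap inner (dom F)); split=> [e|P notP].
  have mid_in : mid e \in [seq mid e | e <- enum (edge G)] ++ pmap inner (dom F).
    by rewrite mem_cat map_f ?mem_enum.
  by exists (SeqSub mid_in); exact: midE.
apply: coeff_outdom; apply/negP => P_dom.
case: P notP P_dom => [u|p] notP P_dom; first exact: (notP (inl u)).
have p_in : p \in [seq mid e | e <- enum (edge G)] ++ pmap inner (dom F).
  by rewrite mem_cat mem_pmap orbC; apply/orP; left; apply/mapP; exists (inr p).
exact: (notP (inr (SeqSub p_in))).
Qed.

(** [finite_residual] for a subdivision that contains the support of F: potentials
    with effective result on the finite graph and rational functions with
    effective result on the curve can be turned into each other. *)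
Theorem residual_divisor F : (forall H, ~ linear_system F H) ->
  exists E, [/\ effective E, deg E = genus G - 1 - deg F &
    forall H, ~ linear_system (canonical - F - E) H].
Proof.
move=> F_empty; have [s [s_meets F_s]] := exists_model F.
pose a (v : mvertex s) := coeff (mpoint v) F.
have degF : deg F = \sum_v a v.
  rewrite -deg_model_divisor; congr deg; apply/eqP/freeg_eqP => P.
  have [[v <-]|notP] := pselect (exists v : mvertex s, mpoint v = P).
    by rewrite coeff_model_divisor.
  have {}notP (v : mvertex s) : mpoint v <> P by move=> vP; apply: notP; exists v.
  by rewrite coeff_model_divisor0 // F_s.
have [|b [b_ge0 b_sum b_empty]] := finite_residual (src := @ssrc _ _ s) (tgt := @stgt _ _ s)
    (@slen_gt0 _ _ s)
    (segment_loopless s_meets) (@model_connected _ _ s) (F := a).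
  move=> phi phiP; pose g := fun_of_potential phi.
  have [_ _ pl] := rational_fun_of_potential phi.
  apply: (F_empty (F + divisor_of g)); split; last first.
    by rewrite /lin_equiv addrC addKr; exists g => //; exact: rational_fun_of_potential.
  move=> P; rewrite coeffD coeff_divisor_of //.
  have [[v <-]|notP] := pselect (exists v : mvertex s, mpoint v = P).
    by apply: le_trans (phiP v) _; rewrite lerD2l fdiv_le_ord_at.
  have {}notP (v : mvertex s) : mpoint v <> P by move=> vP; apply: notP; exists v.
  by rewrite F_s // add0r ord_at_inner_ge0.
exists (model_divisor b); split=> [P||H [H_eff [f rat_f Hf]]].
- have [[v <-]|notP] := pselect (exists v : mvertex s, mpoint v = P).
    by rewrite coeff_model_divisor.
  have {}notP (v : mvertex s) : mpoint v <> P by move=> vP; apply: notP; exists v.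
  by rewrite coeff_model_divisor0.
- by rewrite deg_model_divisor b_sum card_segment degF.
have [_ _ pl] := rat_f.
have HE P : coeff P H = coeff P (canonical - F - model_divisor b) + ord_at f P.
  by rewrite -coeff_divisor_of // -Hf -coeffD addrC subrK.
have ord_ge0 P : (forall v : mvertex s, mpoint v <> P) -> 0 <= ord_at f P.
  move=> notP; have := H_eff P; rewrite HE !coeffB (coeff_canonical0 notP).
  by rewrite (coeff_model_divisor0 _ notP) F_s // !subr0 add0r.
apply: (b_empty (@potential _ _ s f)) => v; have := H_eff (mpoint v).
rewrite HE !coeffB coeff_canonical coeff_model_divisor => /le_trans; apply.
by rewrite lerD2l ord_at_le_fdiv.
Qed.

Lemma linear_systemD D E H : effective E ->
  linear_system (D - E) H -> linear_system D (H + E).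
Proof.
move=> E_eff [H_eff HD]; split; first by move=> P; rewrite coeffD addr_ge0.
by move: HD; rewrite /lin_equiv opprB addrA.
Qed.

Lemma rank_ge_monotone D r t : (r <= t)%N -> rank_ge D t -> rank_ge D r.
Proof.
move=> rt Dt E E_eff degE.
have /card_gt0P[u _] : (0 < #|vertex G|)%N by case: (graph_conn G).
pose E1 : divisor G := << (t - r)%:Z *g (inl u : tpoint G) >>.
have E1_eff : effective E1 by move=> P; rewrite coeffU mulr_ge0.
have [||H HD] := Dt (E + E1).
- by move=> P; rewrite coeffD addr_ge0.
- by rewrite degD degU degE; lia.
exists (H + E1); apply: linear_systemD E1_eff _.
by rewrite -addrA -opprD.
Qed.

Lemma rankP D (r : nat) : (0 < r)%N -> rank D = r%:Z ->
  rank_ge D r /\ ~ rank_ge D r.+1.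
Proof.
rewrite /rank; case: pselect => // _ r_gt0 [rE].
set S := [set _ | _]%classic in rE.
have [Sr|noS] := pselect (exists x, S x).
  have := xgetPex 0%N Sr; rewrite rE => -[Dr rmax]; split=> // /rmax.
  by rewrite ltnn.
by move: r_gt0; rewrite -rE xgetPN // => x Sx; apply: noS; exists x.
Qed.

Lemma rank_eq1 D : rank_ge D 1 -> ~ rank_ge D 2 -> rank D = 1.
Proof.
move=> D1 D2; rewrite /rank; case: pselect => [?|noD] /=; last first.
  exfalso; apply: noD.
  have [||H] := @rank_ge_monotone D 0 1 isT D1 0.
  - by move=> P; rewrite coeff0.
  - exact: deg0.
  by rewrite subr0 => HD; exists H.
congr Posz; apply: xget_unique.
  split=> // t Dt; rewrite leqNgt; apply/negP => t2.
  exact: D2 (rank_ge_monotone t2 Dt).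
move=> t [Dt tmax]; apply/eqP; rewrite eqn_leq tmax // andbT leqNgt.
by apply/negP => t2; exact: D2 (rank_ge_monotone t2 Dt).
Qed.

(** Both bounds on the rank of K - D come from [residual_divisor].  If |K - D - P|
    were empty, there would be an effective E of degree 2 with |D + P - E| empty,
    against rank D >= 2.  As rank D < 3, there is an effective P of degree 3 with
    |D - P| empty, hence an effective E of degree 2 with |K - D - E + P| empty;
    then |K - D - E| is empty as well. *)
Lemma residual_rank D : genus G = 4 -> deg D = 4 -> rank D = 2 ->
  rank (canonical - D) = 1.
Proof.
move=> g4 degD4 /(@rankP D 2 isT)[D2 D3].
have degK : deg canonical = 6 by rewrite deg_canonical g4.
apply: rank_eq1 => [P P_eff degP|KD2].
  apply: contrapT => noKDP.
  have [H HL|E [E_eff degE DP]] := @residual_divisor (canonical - D - P).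
    by apply: noKDP; exists H.
  have [|H HD] := D2 E E_eff; first by rewrite degE !degB degK degD4 degP g4.
  apply: (DP (H + P)).
  have -> : canonical - (canonical - D - P) - E = D - E + P.
    apply/eqP/freeg_eqP => Q; rewrite !(coeffB, coeffD); lia.
  apply: (linear_systemD P_eff).
  by rewrite addrK.
apply: D3 => P P_eff degP; apply: contrapT => noDP.
have [H HL|E [E_eff degE KDP]] := @residual_divisor (D - P).
  by apply: noDP; exists H.
have [|H HD] := KD2 E E_eff; first by rewrite degE !degB degP degD4 g4.
apply: (KDP (H + P)).
have -> : canonical - (D - P) - E = canonical - D - E + P.
  apply/eqP/freeg_eqP => Q; rewrite !(coeffB, coeffD); lia.
apply: (linear_systemD P_eff).
by rewrite addrK.
Qed.

End Divisors.

Theorem mainTheorem2 (R : realType) (G : tropical_curve R) (D : divisor G) :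
  genus G <= 4 ->
  effective D ->
  0 < deg D -> deg D < 2 * genus G - 2 ->
  (rank D)%:Q = (deg D)%:Q / 2 ->
  hyperelliptic G.
Proof.
move=> g_le _ deg_gt0 deg_lt rkD.
have rk2 : rank D * 2 = deg D.
  apply/eqP; rewrite -(eqr_int rat) intrM rkD divfK //.
have [deg2|deg4] : deg D = 2 \/ deg D = 4 /\ genus G = 4 by lia.
  by exists D; split => //; lia.
exists (canonical - D); split; first by rewrite degB deg_canonical; lia.
by apply: residual_rank; lia.
Qed.
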